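(* For every $p\in(1,\infty)$ there exists a finite constant $C_p$ (depending only on $p$) such that for every integer $n\geq1$, every integer $d\ge 0$ and every analytic polynomial $f:\mathbb{C}^n\to\mathbb{C}$ with $f\in\mathcal{P}^{\leq d}$, $$\|\nabla f\|_{L^p(d\gamma_{2n})} \leq C_p\,\sqrt{d}\,\|f\|_{L^p(d\gamma_{2n})}.$$
   Context: Identify $\mathbb{C}^n\cong\mathbb{R}^{2n}$ via $z_j=x_j+iy_j$. $d\gamma_{2n}(x) = (2\pi)^{-n}e^{-|x|^2/2}\,dx$ is the standard Gaussian measure on $\mathbb{R}^{2n}$ ($|\cdot|$ the Euclidean norm), and $\|f\|_{L^p(d\gamma_{2n})} = (\int |f|^p\,d\gamma_{2n})^{1/p}$. $\nabla$ is the gradient with respect to all $2n$ real coordinates, and $\|\nabla f\|_{L^p(d\gamma_{2n})}$ is the $L^p(d\gamma_{2n})$ norm of $|\nabla f|=(\sum_{j=1}^n |\partial_{x_j}f|^2+|\partial_{y_j}f|^2)^{1/2}$. $\mathcal{P}^{\leq d}$ is the space of complex-coefficient polynomials on $\mathbb{R}^{2n}$ of total degree at most $d$. An analytic polynomial on $\mathbb{C}^n$ is a function of the form $f(z)=\sum_\alpha c_\alpha z^\alpha$ (finite sum over multi-indices $\alpha$ of nonnegative integers, $c_\alpha\in\mathbb{C}$), where $z^\alpha=\prod_{j=1}^n z_j^{\alpha_j}$; it is regarded as a complex-valued polynomial on $\mathbb{R}^{2n}$. *)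

(* Defs.v *)
From HB Require Import structures.
From mathcomp Require Import all_boot all_order all_algebra.
(* Without its notations, which clash with those of MathComp-Analysis. *)
From mathcomp Require Import -(notations) mpoly.
From mathcomp Require Import all_classical all_reals all_analysis.
From mathcomp Require Import measurable_realfun complex.

Set Implicit Arguments.
Unset Strict Implicit.
Unset Printing Implicit Defensive.

Import Order.TTheory GRing.Theory Num.Theory.
Import numFieldNormedType.Exports.

Local Open Scope classical_set_scope.
Local Open Scope ring_scope.
Local Open Scope complex_scope.

Definition tcons (T : Type) (n : nat) (xt : T * n.-tuple T) : n.+1.-tuple T :=
  [tuple of xt.1 :: xt.2].

Lemma measurable_tcons d (T : measurableType d) (n : nat) :
  measurable_fun [set: T * n.-tuple T] (@tcons T n).
Proof. by apply: measurable_cons. Qed.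

Lemma measurable_untcons d (T : measurableType d) (n : nat) :
  measurable_fun [set: n.+1.-tuple T]
    (fun t : n.+1.-tuple T => (thead t, [tuple of behead t])).
Proof.
apply: measurable_fun_pair; first exact: measurable_tnth.
exact: measurable_behead.
Qed.

(* mu \x nu, renamed because the library's canonical sigma-finite instance on
   \x only fires for products of subprobabilities. *)
Section sigma_finite_product.
Local Open Scope ereal_scope.
Context d1 d2 (T1 : measurableType d1) (T2 : measurableType d2) (R : realType).
Variable mu : {sigma_finite_measure set T1 -> \bar R}.
Variable nu : {sigma_finite_measure set T2 -> \bar R}.

Definition prod_measure : set (T1 * T2) -> \bar R := mu \x nu.

HB.instance Definition _ := Measure.copy prod_measure (mu \x nu).

Let prod_measure_sigma_finite : sigma_finite setT prod_measure.
Proof.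
have /sigma_finiteP[F [TF ndF Foo]] := sigma_finiteT mu.
have /sigma_finiteP[G [TG ndG Goo]] := sigma_finiteT nu.
exists (fun k => F k `*` G k).
  rewrite -setXTT TF TG predeqE => -[x y]; split.
    move=> [/= [i _ Fix] [k _ Gky]]; exists (maxn i k) => //; split.
    - by move: x Fix; exact/subsetPset/ndF/leq_maxl.
    - by move: y Gky; exact/subsetPset/ndG/leq_maxr.
  by move=> [i _ []/= ? ?]; split; exists i.
move=> k; have [? ?] := Foo k; have [? ?] := Goo k.
split; first exact: measurableX.
by rewrite /prod_measure product_measure1E// lte_mul_pinfty// ge0_fin_numE.
Qed.

HB.instance Definition _ := Measure_isSigmaFinite.Build _ _ _ prod_measure
  prod_measure_sigma_finite.

End sigma_finite_product.

Section power_measure_step.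
Local Open Scope ereal_scope.
Context d (T : measurableType d) (R : realType) (n : nat).
Variable mu : {sigma_finite_measure set T -> \bar R}.
Variable nu : {sigma_finite_measure set (n.-tuple T) -> \bar R}.

Definition power_measureS : set (n.+1.-tuple T) -> \bar R :=
  pushforward (prod_measure mu nu) (@tcons T n).

Let preim_meas (A : set (n.+1.-tuple T)) :
  measurable A -> measurable (@tcons T n @^-1` A).
Proof.
by move=> mA; rewrite -[X in measurable X]setTI; exact: measurable_tcons.
Qed.

Let pm0 : power_measureS set0 = 0.
Proof. by rewrite /power_measureS /pushforward preimage_set0 measure0. Qed.

Let pm_ge0 A : 0 <= power_measureS A.
Proof. by rewrite /power_measureS /pushforward; exact: measure_ge0. Qed.

Let pm_sigma_additive : semi_sigma_additive power_measureS.
Proof.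
move=> F mF tF mUF; rewrite /power_measureS /pushforward preimage_bigcup.
apply: measure_semi_sigma_additive.
- by move=> k; exact: preim_meas.
- apply/trivIsetP => /= i j _ _ ij; rewrite -preimage_setI.
  by move/trivIsetP : tF => /(_ _ _ _ _ ij) ->//; rewrite preimage_set0.
- by rewrite -preimage_bigcup; exact: preim_meas.
Qed.

HB.instance Definition _ := isMeasure.Build _ _ _ power_measureS
  pm0 pm_ge0 pm_sigma_additive.

Let pm_sigma_finite : sigma_finite setT power_measureS.
Proof.
have [F TF mF] : sigma_finite setT (prod_measure mu nu) by exact: sigma_finiteT.
pose h (t : n.+1.-tuple T) := (thead t, [tuple of behead t]).
have hK : cancel (@tcons T n) h.
  by move=> [x t]; rewrite /h /= theadE; congr pair; exact/val_inj.
exists (fun k => h @^-1` F k).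
  by rewrite -preimage_bigcup -TF preimage_setT.
move=> k; have [mFk Fkoo] := mF k; split.
  by rewrite -[X in measurable X]setTI; exact: measurable_untcons.
rewrite /power_measureS /pushforward -comp_preimage.
rewrite (_ : h \o _ = id) ?preimage_id//.
by apply/funext => xt; exact: hK.
Qed.

HB.instance Definition _ := Measure_isSigmaFinite.Build _ _ _ power_measureS
  pm_sigma_finite.

End power_measure_step.

(* The n-fold product mu x ... x mu; the empty product is the unit mass. *)
Fixpoint power_measure d (T : measurableType d) (R : realType)
    (mu : {sigma_finite_measure set T -> \bar R}) (n : nat) :
    {sigma_finite_measure set (n.-tuple T) -> \bar R} :=
  match n with
  | 0 => \d_[tuple]
  | n'.+1 => power_measureS mu (power_measure mu n')
  end.

(* R^(2n) is (R^2)^n: a point is the tuple of its pairs (x_j, y_j). *)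
Definition R2n (R : realType) (n : nat) : Type :=
  n.-tuple (measurableTypeR R * measurableTypeR R).

HB.instance Definition _ (R : realType) (n : nat) := Measurable.on (R2n R n).

Definition xcoord (R : realType) (n : nat) (w : R2n R n) (j : 'I_n) : R :=
  (tnth w j).1.

Definition ycoord (R : realType) (n : nat) (w : R2n R n) (j : 'I_n) : R :=
  (tnth w j).2.

Definition euclidean_norm (R : realType) (n : nat) (w : R2n R n) : R :=
  Num.sqrt (\sum_(j < n) (xcoord w j ^+ 2 + ycoord w j ^+ 2)).

Definition lebesgue_R2n (R : realType) (n : nat) :
    {sigma_finite_measure set (R2n R n) -> \bar R} :=
  power_measure (prod_measure (@lebesgue_measure R) (@lebesgue_measure R)) n.

Section gaussian_measure.
Context (R : realType) (n : nat).

Definition gaussian_density (w : R2n R n) : R :=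
  ((2 * pi) ^+ n)^-1 * expR (- (euclidean_norm w ^+ 2) / 2).

Definition gaussian_measure (A : set (R2n R n)) : \bar R :=
  (\int[lebesgue_R2n R n]_(w in A) (gaussian_density w)%:E)%E.

Lemma gaussian_density_ge0 (w : R2n R n) : 0 <= gaussian_density w.
Proof.
by rewrite mulr_ge0 ?expR_ge0// invr_ge0 exprn_ge0// mulr_ge0// pi_ge0.
Qed.

Lemma measurable_gaussian_density :
  measurable_fun [set: R2n R n] gaussian_density.
Proof.
apply: measurable_funM => //; apply: measurableT_comp => //.
apply: measurable_funM => //; apply: measurableT_comp => //.
rewrite (_ : (fun _ => _) = fun w : R2n R n =>
    \sum_(j < n) (xcoord w j ^+ 2 + ycoord w j ^+ 2)); last first.
  apply/funext => w; rewrite sqr_sqrtr// sumr_ge0// => j _.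
  by rewrite addr_ge0 ?sqr_ge0.
apply: measurable_sum => j; apply: measurable_funD; apply: measurable_funX.
- apply: (@measurableT_comp _ _ _ _ _ _ fst) => //; exact: measurable_tnth.
- apply: (@measurableT_comp _ _ _ _ _ _ snd) => //; exact: measurable_tnth.
Qed.

Let gaussian0 : gaussian_measure set0 = 0%E.
Proof. by rewrite /gaussian_measure integral_set0. Qed.

Let gaussian_ge0 A : (0 <= gaussian_measure A)%E.
Proof.
by apply: integral_ge0 => w _; rewrite lee_fin gaussian_density_ge0.
Qed.

Let gaussian_sigma_additive : semi_sigma_additive gaussian_measure.
Proof.
move=> F mF tF mUF.
rewrite /gaussian_measure ge0_integral_bigcup//=; last 2 first.
- apply/measurable_EFinP; apply: measurable_funTS.
  exact: measurable_gaussian_density.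
- by move=> w _; rewrite lee_fin gaussian_density_ge0.
apply: is_cvg_ereal_nneg_natsum_cond => k _ _.
by apply: integral_ge0 => w _; rewrite lee_fin gaussian_density_ge0.
Qed.

HB.instance Definition _ := isMeasure.Build _ _ _ gaussian_measure
  gaussian0 gaussian_ge0 gaussian_sigma_additive.

End gaussian_measure.

Definition Lpnorm_gaussian (R : realType) (n : nat) (p : R)
    (g : R2n R n -> R) : \bar R :=
  'N[@gaussian_measure R n]_p%:E[EFin \o g].

Definition complex_point (R : realType) (n : nat) (w : R2n R n) :
    'I_n -> R[i] :=
  fun j => xcoord w j +i* ycoord w j.

Definition on_R2n (R : realType) (n : nat) (f : ('I_n -> R[i]) -> R[i]) :
    R2n R n -> R[i] :=
  fun w => f (complex_point w).

Definition analytic_polynomial (R : realType) (n : nat)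
    (f : ('I_n -> R[i]) -> R[i]) : Prop :=
  exists P : mpoly n R[i], forall z, f z = meval z P.

(* The 2n real coordinates, in the order x_1, ..., x_n, y_1, ..., y_n, as
   elements of R[i] at which polynomials with complex coefficients can be
   evaluated. *)
Definition real_coords (R : realType) (n : nat) (w : R2n R n) :
    'I_(n + n) -> R[i] :=
  fun k => match fintype.split k with
           | inl j => (xcoord w j)%:C
           | inr j => (ycoord w j)%:C
           end.

(* mmeasure mdeg is msize, i.e. 1 + total degree (and 0 for the zero
   polynomial), hence the successor. *)
Definition polynomial_degree_le (R : realType) (n d : nat)
    (g : R2n R n -> R[i]) : Prop :=
  exists Q : mpoly (n + n) R[i],
    (mmeasure mdeg Q <= d.+1)%N /\
    forall w, g w = meval (real_coords w) Q.

Definition update (T : Type) (n : nat) (w : n.-tuple T) (j : 'I_n) (u : T) :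
    n.-tuple T :=
  [tuple if k == j then u else tnth w k | k < n].

(* Componentwise, since R[i] is not a normed module over R in the library. *)
Definition cderive1 (R : realType) (h : R -> R[i]) (t : R) : R[i] :=
  (fun s => complex.Re (h s))^`()%classic t +i*
  (fun s => complex.Im (h s))^`()%classic t.

Definition partial_x (R : realType) (n : nat) (g : R2n R n -> R[i])
    (j : 'I_n) (w : R2n R n) : R[i] :=
  cderive1 (fun t => g (update w j (t, ycoord w j))) (xcoord w j).

Definition partial_y (R : realType) (n : nat) (g : R2n R n -> R[i])
    (j : 'I_n) (w : R2n R n) : R[i] :=
  cderive1 (fun t => g (update w j (xcoord w j, t))) (ycoord w j).

(* normc is the modulus as an element of R, whereas `|z| lives in R[i]. *)
Definition cmod (R : realType) (z : R[i]) : R := ComplexField.Normc.normc z.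

Definition gradient_norm (R : realType) (n : nat) (g : R2n R n -> R[i])
    (w : R2n R n) : R :=
  Num.sqrt (\sum_(j < n) (cmod (partial_x g j w) ^+ 2 +
                          cmod (partial_y g j w) ^+ 2)).

(* Main.v *)
From HB Require Import structures.
Require Import Defs.
From mathcomp Require Import all_boot all_order all_algebra.
From mathcomp Require Import cyclic separable cyclotomic.
From mathcomp Require Import -(notations) mpoly.
From mathcomp Require Import all_classical all_reals all_analysis.
From mathcomp Require Import measurable_realfun complex.
From mathcomp Require Import ring lra zify.

Set Implicit Arguments.
Unset Strict Implicit.
Unset Printing Implicit Defensive.

Import Order.TTheory GRing.Theory Num.Theory.
Import numFieldNormedType.Exports.

Local Open Scope classical_set_scope.
Local Open Scope ring_scope.

(** Let [D_j] be the complex partial derivatives of the analytic polynomial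
[f]. By the Cauchy-Riemann equations the Euclidean gradient of [f] is
[sqrt 2] times the Hermitian length of [(D_1, ..., D_n)], see
[gradient_normE], so it suffices to bound [S = (sum_j |D_j|^2)^(1/2)].

If [v] is a standard Gaussian vector, then for fixed [w] the number
[sum_j D_j(w) v_j] is a centered complex Gaussian of size [S w]; its [p]-th
absolute moment is therefore [S w ^ p] times a constant [kappa] that depends
on [p] alone ([integral_tdot_powR]), and [kappa > 0] ([gaussian_moment_gt0]).
On the other hand [r * sum_j D_j(w) v_j] is the coefficient of [t] in the
polynomial [f (w + t r v)] of one variable, hence an average of the values of
this polynomial at roots of unity [u], up to unimodular factors
([coef1_circle]). Since [w] and [v] are independent, [w + u r v] has the law
of [s w] with [s^2 = 1 + r^2] ([gaussn_comb]), and Jensen's inequality gives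
[kappa * ||r S||_p^p <= ||f (s .)||_p^p] ([integral_derivative_le]).

It remains to undo the dilation. On the line [t |-> f (t w)] the dilation
multiplies the coefficient of [t^k] by [s^k = s^d * (1/s)^(d-k)], and the
sequence [rho^m], [0 <= m <= d], is convex and decreasing when
[0 <= rho <= 1]: it is a nonnegative combination of the constant sequence and
of the triangles [m |-> (j - m)_+], which are Fourier coefficients of the
nonnegative Fejer kernels. Thus the dilation is [s^d] times an average of
rotations ([horner_dilation]), and the Gaussian measure is invariant under
rotations, so that [||f (s .)||_p <= s^d ||f||_p] ([integral_dilation_le]).
With [r = d^(-1/2)] the factor [s^d = (1 + 1/d)^(d/2)] is at most [e], and
the inequality follows with the constant [sqrt 2 * e * kappa^(-1/p)].

The laws of linear combinations of Gaussian vectors reduce, one coordinate at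
a time, to the rotation invariance of the Gaussian measure of the plane
([cgauss_rotation]). There the density is radial, and Lebesgue measure is
invariant because a rotation is a product of three shears, each of which is a
translation on every line parallel to its axis ([lebesgue_rotation]). *)

(** * Averages over roots of unity *)

Section roots_of_unity.

Lemma prim_root_exists (F : numClosedFieldType) (N : nat) :
  (0 < N)%N -> exists z : F, N.-primitive_root z.
Proof.
move=> N_gt0; have [r Dr] := closed_field_poly_normal ('X^N - 1 : {poly F}).
move: Dr; rewrite (monicP _) ?monicXnsubC // scale1r => Dr.
have rn1 : all N.-unity_root r by apply/allP=> z; rewrite -root_prod_XsubC -Dr.
have sz_r : (N < (size r).+1)%N.
  by rewrite -(size_prod_XsubC r id) -Dr size_XnsubC.
have [|z _ Pz] := hasP (has_prim_root N_gt0 rn1 _ sz_r); last by exists z.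
by rewrite -separable_prod_XsubC -Dr separable_Xn_sub_1 // pnatr_eq0 -lt0n.
Qed.

Lemma sum_prim_root (F : fieldType) (N : nat) (z : F) (m : nat) :
  N.-primitive_root z ->
  \sum_(k < N) z ^+ (k * m) = (N * (N %| m))%N%:R.
Proof.
move=> Pz; rewrite (prim_order_dvd Pz).
have -> : \sum_(k < N) z ^+ (k * m) = \sum_(k < N) (z ^+ m) ^+ k.
  by apply: eq_bigr => k _; rewrite mulnC exprM.
have [->|zm1] := eqVneq (z ^+ m) 1.
  rewrite muln1 (eq_bigr (fun=> 1)) => [|k _]; last by rewrite expr1n.
  by rewrite sumr_const card_ord.
rewrite muln0; apply/(mulfI (_ : z ^+ m - 1 != 0)); first by rewrite subr_eq0.
by rewrite mulr0 -subrX1 -exprM mulnC exprM (prim_expr_order Pz) expr1n subrr.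
Qed.

End roots_of_unity.

Section complex_modulus.
Variable R : realType.
Implicit Types z : R[i].

Lemma cmodE z : (cmod z)%:C%C = `|z|.
Proof. by []. Qed.

Lemma cmod_ge0 z : 0 <= cmod z.
Proof. by rewrite -ler0c cmodE. Qed.

Lemma cmodM z1 z2 : cmod (z1 * z2) = cmod z1 * cmod z2.
Proof. exact: ComplexField.Normc.normcM. Qed.

Lemma cmod_real (x : R) : 0 <= x -> cmod x%:C%C = x.
Proof.
move=> x0; apply: complexI; rewrite cmodE ger0_norm// ler0c//.
Qed.

Lemma cmod_sum (I : Type) (r : seq I) (F : I -> R[i]) :
  cmod (\sum_(i <- r) F i) <= \sum_(i <- r) cmod (F i).
Proof.
rewrite -lecR cmodE rmorph_sum; under [X in _ <= X]eq_bigr do rewrite /= cmodE.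
exact: ler_norm_sum.
Qed.

Lemma cmod_unity (N : nat) z : (0 < N)%N -> z ^+ N = 1 -> cmod z = 1.
Proof.
move=> N0 zN; apply/eqP; rewrite -(@pexpr_eq1 _ _ N) ?cmod_ge0//.
by apply/eqP; apply: complexI; rewrite rmorphXn /= cmodE -normrX zN normr1.
Qed.

End complex_modulus.

Section jensen.
Variables (R : realType) (p : R).

(** Young's inequality for [t] and [1]. *)
Lemma powR_tangent (t : R) : 1 < p -> 0 <= t -> 1 + p * (t - 1) <= t `^ p.
Proof.
move=> p1 t0; have p0 : 0 < p by lra.
have p10 : p - 1 != 0 by rewrite gt_eqF// subr_gt0.
have q0 : 0 < p / (p - 1) by apply: divr_gt0; lra.
have := @conjugate_powR R t 1 p (p / (p - 1)) t0 ler01 p0 q0.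
have pq : p^-1 + (p / (p - 1))^-1 = 1.
  by rewrite invf_div; field; rewrite gt_eqF.
move=> /(_ pq); rewrite mulr1 powR1 => h.
have : p * t <= p * (t `^ p / p + 1 / (p / (p - 1))) by rewrite ler_pM2l.
have -> : p * (t `^ p / p + 1 / (p / (p - 1))) = t `^ p + (p - 1).
  by field; rewrite p10 gt_eqF.
by lra.
Qed.

(** Apply the tangent inequality at the mean: the linear terms cancel. *)
Lemma powR_jensen (N : nat) (a x : 'I_N -> R) :
  1 < p ->
  (forall k, 0 <= a k) -> \sum_k a k = 1 -> (forall k, 0 <= x k) ->
  (\sum_k a k * x k) `^ p <= \sum_k a k * x k `^ p.
Proof.
move=> p1 a0 a1 x0; have p0 : p != 0 by rewrite gt_eqF//; lra.
set X := \sum_k a k * x k.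
have X0 : 0 <= X by apply: sumr_ge0 => k _; rewrite mulr_ge0.
have [XE|Xn] := eqVneq X 0.
  by rewrite XE powR0// sumr_ge0// => k _; rewrite mulr_ge0// powR_ge0.
have Xp : 0 < X by rewrite lt_def Xn.
have -> : \sum_k a k * x k `^ p = X `^ p * \sum_k a k * (x k / X) `^ p.
  rewrite mulr_sumr; apply: eq_bigr => k _.
  rewrite mulrCA -powRM ?divr_ge0//; congr (_ * _ `^ _).
  by rewrite mulrC divfK.
rewrite ler_peMr ?powR_ge0//.
apply: (@le_trans _ _ (\sum_k a k * (1 + p * (x k / X - 1)))); last first.
  by apply: ler_sum => k _; rewrite ler_wpM2l// powR_tangent// divr_ge0.
rewrite (eq_bigr (fun k => (1 - p) * a k + p / X * (a k * x k))); last first.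
  by move=> k _; field.
by rewrite big_split /= -!mulr_sumr a1 -/X divfK// mulr1 subrK.
Qed.

End jensen.

(** * Positive multipliers and the Fejer kernel *)

Section fejer.
Variable R : realType.

(** Multiplying the coefficient of [t^m] by [phi m], for [m <= d], is the
same as averaging over rotations with the nonnegative weights [a]. *)
Definition positive_multiplier (N : nat) (w : R[i]) (d : nat)
    (phi : nat -> R) :=
  exists2 a : 'I_N -> R, (forall k, 0 <= a k) &
    forall m, (m <= d)%N -> \sum_k (a k)%:C%C * w ^+ (k * m) = (phi m)%:C%C.

Variables (N : nat) (w : R[i]) (d : nat).
Hypothesis Pw : N.-primitive_root w.

Local Notation pm := (positive_multiplier N w d).

Lemma eq_positive_multiplier (phi psi : nat -> R) :
  (forall m, (m <= d)%N -> phi m = psi m) -> pm phi -> pm psi.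
Proof. by move=> e [a a0 ha]; exists a => // m md; rewrite ha// e. Qed.

Lemma positive_multiplierD (phi psi : nat -> R) :
  pm phi -> pm psi -> pm (fun m => phi m + psi m).
Proof.
move=> [a a0 ha] [b b0 hb]; exists (fun k => a k + b k) => [k|m md].
  by rewrite addr_ge0.
rewrite rmorphD /= -ha// -hb// -big_split /=.
by apply: eq_bigr => k _; rewrite rmorphD /= mulrDl.
Qed.

Lemma positive_multiplierZ (c : R) (phi : nat -> R) :
  0 <= c -> pm phi -> pm (fun m => c * phi m).
Proof.
move=> c0 [a a0 ha]; exists (fun k => c * a k) => [k|m md].
  by rewrite mulr_ge0.
rewrite rmorphM /= -ha// mulr_sumr.
by apply: eq_bigr => k _; rewrite rmorphM /= mulrA.
Qed.

Lemma positive_multiplier_cst : pm (fun=> 1).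
Proof.
have N0 : (0 < N)%N := prim_order_gt0 Pw.
exists (fun k => (k == Ordinal N0)%:R) => [k|m _]; first by rewrite ler0n.
rewrite (bigD1 (Ordinal N0))//= mul0n expr0 mulr1 big1 ?addr0// => k /negbTE ->.
by rewrite mul0r.
Qed.

Lemma positive_multiplier_sum (I : Type) (r : seq I) (phi : I -> nat -> R) :
  (forall i, pm (phi i)) -> pm (fun m => \sum_(i <- r) phi i m).
Proof.
move=> h; elim: r => [|i r ih].
  apply: (@eq_positive_multiplier (fun m => 0 * 1)).
    by move=> m _; rewrite big_nil mul0r.
  by apply: positive_multiplierZ => //; exact: positive_multiplier_cst.
apply: (@eq_positive_multiplier (fun m => phi i m + \sum_(i <- r) phi i m)).
  by move=> m _; rewrite big_cons.
exact: positive_multiplierD.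
Qed.

(** The weights are those of the Fejer kernel: up to the factor [1 / N], the
squared modulus of [sum_(u < j) w^(k u)]. The coefficient at [m] counts the
pairs [u, v < j] with [v = u + m]; the condition [j + d <= N] excludes
solutions of this equation that hold modulo [N] only. *)
Lemma positive_multiplier_triangle (j : nat) :
  (j + d <= N)%N -> pm (fun m => (j - m)%:R).
Proof.
move=> jdN; have N0 : (0 < N)%N := prim_order_gt0 Pw.
have wN := prim_expr_order Pw.
have wn : `|w| = 1 by rewrite -cmodE (cmod_unity N0 wN).
have wJ : conjc w = w ^+ N.-1.
  apply: (mulfI (_ : w != 0)); first by rewrite -normr_gt0 wn.
  by rewrite -exprS prednK// wN -sqr_normc wn expr1n.
have Nn : N%:R != 0 :> R[i] by rewrite pnatr_eq0 -lt0n.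
pose D (k : 'I_N) := \sum_(u < j) w ^+ (k * u).
exists (fun k => cmod (D k) ^+ 2 / N%:R) => [k|m md].
  by rewrite divr_ge0// sqr_ge0.
have DE k : (cmod (D k) ^+ 2 / N%:R)%:C%C * w ^+ (k * m) =
    N%:R^-1 * \sum_(u < j) \sum_(v < j) w ^+ (k * (u + N.-1 * v + m)).
  rewrite rmorphM rmorphXn fmorphV /= cmodE sqr_normc rmorph_nat rmorph_sum /=.
  rewrite mulrC [_ / _]mulrC mulrCA; congr (_ * _).
  rewrite mulrC -mulrA mulr_suml; apply: eq_bigr => u _.
  rewrite mulr_suml mulr_sumr; apply: eq_bigr => v _.
  rewrite rmorphXn /= wJ -exprM -!exprD; congr (_ ^+ _).
  by lia.
rewrite (eq_bigr _ (fun k _ => DE k)) -mulr_sumr exchange_big /=.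
under eq_bigr do rewrite exchange_big /=.
apply: (mulfI Nn); rewrite mulVKf//.
transitivity (\sum_(u < j) \sum_(v < j) (N * (v == u + m :> nat))%N%:R : R[i]).
  apply: eq_bigr => u _; apply: eq_bigr => v _.
  rewrite (sum_prim_root _ Pw); congr (_ * nat_of_bool _)%:R.
  have uj := ltn_ord u; have vj := ltn_ord v.
  apply/idP/eqP => [h|->]; last first.
    by apply/dvdnP; exists (u + m)%N; nia.
  have /dvdnP[q qE] := h.
  have [qv|qv|qv] := ltngtP q v; last by subst q; nia.
  - by have := leq_mul qv (leqnn N); nia.
  - by have := leq_mul qv (leqnn N); nia.
have count c : (\sum_(u < j) (u < c) = minn c j)%N.
  elim: {md jdN D DE} j => [|i ih]; first by rewrite big_ord0 minn0.
  by rewrite big_ord_recr /= ih; lia.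
rewrite rmorph_nat -natrM -(minn_idPl (leq_subr m j)) -count big_distrr natr_sum /=.
apply: eq_bigr => u _; have [ujm|jmu] := ltnP u (j - m).
  have umj : (u + m < j)%N by lia.
  rewrite (bigD1 (Ordinal umj))//= eqxx big1 ?addr0// => v vu.
  by rewrite (_ : (v == _ :> nat) = false) ?muln0//; apply/negbTE.
rewrite muln0 big1// => v _; rewrite (_ : (v == _ :> nat) = false) ?muln0//.
by have := ltn_ord v; lia.
Qed.

(** On [0, d], a nonnegative, convex and decreasing sequence is a nonnegative
combination of the constant sequence and of triangles, with its second
differences as coefficients. *)
Lemma positive_multiplier_geometric (rho : R) :
  0 <= rho <= 1 -> (d + d <= N)%N -> pm (fun m => rho ^+ m).
Proof.
move=> /andP[r0 r1] ddN.
pose T (j m : nat) : R := (j - m)%:R.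
(* Summation by parts on [0, d]; the last triangle carries the slope of the
   sequence at its end point. *)
apply: (@eq_positive_multiplier (fun m => rho ^+ d * 1 + (1 - rho) *
    (rho ^+ d * T d m + (1 - rho) * \sum_(j < d) rho ^+ j * T j.+1 m))).
  move=> m md; rewrite mulr1.
  have {md} [i ->] : exists i, d = (m + i)%N by exists (d - m)%N; lia.
  elim: i => [|i ih].
    rewrite addn0 big1 => [|j _]; last first.
      by rewrite /T (_ : j.+1 - m = 0)%N ?mulr0//; have := ltn_ord j; lia.
    by rewrite /T subnn !mulr0 addr0 mulr0 addr0.
  rewrite -[RHS]ih addnS big_ord_recr /= exprS.
  have -> : T (m + i).+1 m = T (m + i)%N m + 1.
    by rewrite /T -[1]/(1%:R) -natrD; congr _%:R; lia.
  by ring.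
apply: positive_multiplierD.
  by apply: positive_multiplierZ; [rewrite exprn_ge0|exact: positive_multiplier_cst].
apply: positive_multiplierZ; first by rewrite subr_ge0.
apply: positive_multiplierD.
  by apply: positive_multiplierZ; [rewrite exprn_ge0|exact: positive_multiplier_triangle].
apply: positive_multiplierZ; first by rewrite subr_ge0.
apply: positive_multiplier_sum => j.
apply: positive_multiplierZ; first by rewrite exprn_ge0.
by apply: positive_multiplier_triangle; have := ltn_ord j; lia.
Qed.

End fejer.

Section circle_averages.
Variables (R : realType) (p : R).

(** Both polynomial estimates below have an average of this form on their
right-hand side, so that they can be integrated in the same way. *)
Record rotation_average := RotationAverage {
  avg_size : nat;
  avg_weight : 'I_avg_size -> R;
  avg_angle : 'I_avg_size -> R[i];
  avg_weight_ge0 : forall k, 0 <= avg_weight k;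
  avg_weight_sum : \sum_k avg_weight k = 1;
  avg_angle_unit : forall k, cmod (avg_angle k) = 1 }.

(** Reading the coefficients of [q] backwards turns the dilation by [s] into
[s^d] times the multiplier [m |-> (1/s)^m], which is an average of rotations
as [1/s <= 1]; the rest is Jensen's inequality. *)
Lemma horner_dilation (d : nat) (s : R) : 1 < p -> 1 <= s ->
  exists r : rotation_average, forall q : {poly R[i]}, (size q <= d.+1)%N ->
    cmod q.[s%:C%C] `^ p <= (s ^+ d) `^ p *
      \sum_(k < avg_size r) avg_weight k * cmod q.[avg_angle k] `^ p.
Proof.
move=> p1 s1; have s0 : 0 < s by exact: lt_le_trans ltr01 s1.
pose N := (d + d).+1; have [w Pw] := @prim_root_exists R[i] N isT.
have [|a a0 ha] := @positive_multiplier_geometric R N w d Pw s^-1 _ (leqnSn _).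
  by rewrite invr_ge0 ltW//= invf_le1.
have a1 : \sum_k a k = 1.
  apply: complexI; rewrite rmorph1 -[RHS](ha 0%N isT) rmorph_sum /=.
  by apply: eq_bigr => k _; rewrite muln0 mulr1.
have wu m : cmod (w ^+ m) = 1.
  by rewrite (@cmod_unity _ N)// -exprM mulnC exprM (prim_expr_order Pw) expr1n.
exists (@RotationAverage N a (fun k => w ^+ (k * N.-1)) a0 a1 (fun k => wu _)).
move=> q sq /=.
have qE : q.[s%:C%C] = \sum_k (s ^+ d * a k)%:C%C *
    (w ^+ (k * d) * q.[w ^+ (k * N.-1)]).
  rewrite (horner_coef_wide _ sq).
  transitivity (\sum_(m < d.+1) q`_m * ((s ^+ d)%:C%C *
      \sum_k (a k)%:C%C * w ^+ (k * (d - m)))).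
    apply: eq_bigr => m _; rewrite ha ?leq_subr//; congr (_ * _).
    rewrite -rmorphM -rmorphXn /=; congr (_%:C)%C.
    have md : (m <= d)%N by rewrite -ltnS.
    by rewrite -{2}(subnK md) exprD exprVn mulrAC mulfV ?mul1r// expf_neq0// gt_eqF.
  under eq_bigr do rewrite !mulr_sumr.
  rewrite exchange_big /=; apply: eq_bigr => k _.
  rewrite (horner_coef_wide _ sq) !mulr_sumr; apply: eq_bigr => m _.
  have md : (m <= d)%N by rewrite -ltnS.
  suff -> : w ^+ (k * (d - m)) = w ^+ (k * d) * (w ^+ (k * N.-1)) ^+ m.
    by rewrite rmorphM /=; ring.
  rewrite -exprM -exprD.
  rewrite (_ : k * d + _ = k * (d - m) + N * (k * m))%N; last first.
    by rewrite -{1}(subnK md) /N; lia.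
  by rewrite exprD [w ^+ (N * _)]exprM (prim_expr_order Pw) expr1n mulr1.
apply: (@le_trans _ _ ((\sum_k a k * (s ^+ d * cmod q.[w ^+ (k * N.-1)])) `^ p)).
  rewrite ge0_ler_powR ?nnegrE ?cmod_ge0//; first lra.
    by apply: sumr_ge0 => k _; rewrite !mulr_ge0 ?cmod_ge0// exprn_ge0// ltW.
  rewrite qE (le_trans (cmod_sum _ _))//; apply: ler_sum => k _.
  rewrite !cmodM wu mul1r cmod_real ?mulr_ge0// ?exprn_ge0// ?(ltW s0)//.
  by rewrite mulrCA mulrA.
apply: le_trans.
  apply: powR_jensen => // k.
  by rewrite mulr_ge0 ?cmod_ge0// exprn_ge0// ltW.
rewrite mulr_sumr; apply: ler_sum => k _.
by rewrite powRM ?cmod_ge0// ?exprn_ge0// ?(ltW s0)// mulrCA.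
Qed.

(** A Fourier coefficient of [q] on the roots of unity of order [d + 1]: the
degree bound rules out aliasing. *)
Lemma coef1_circle (d : nat) : 1 < p -> (0 < d)%N ->
  exists r : rotation_average, forall q : {poly R[i]}, (size q <= d.+1)%N ->
    cmod q`_1 `^ p <= \sum_(k < avg_size r) avg_weight k * cmod q.[avg_angle k] `^ p.
Proof.
move=> p1 d0; pose N := d.+1; have [w Pw] := @prim_root_exists R[i] N isT.
have wu m : cmod (w ^+ m) = 1.
  by rewrite (@cmod_unity _ N)// -exprM mulnC exprM (prim_expr_order Pw) expr1n.
have a1 : \sum_(k < N) (N%:R^-1 : R) = 1.
  by rewrite sumr_const card_ord -[LHS]mulr_natr mulVf// pnatr_eq0.
have a0 (k : 'I_N) : 0 <= N%:R^-1 :> R by rewrite invr_ge0.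
exists (@RotationAverage N (fun=> N%:R^-1) (fun k => w ^+ k) a0 a1 (fun k => wu _)).
move=> q sq /=.
have qE : q`_1 = \sum_(k < N) (N%:R^-1)%:C%C * (w ^+ (k * N.-1) * q.[w ^+ k]).
  have N0 : N%:R != 0 :> R[i] by rewrite pnatr_eq0.
  apply: (mulfI N0); rewrite mulr_sumr.
  transitivity (\sum_(m < N) q`_m * \sum_(k < N) w ^+ (k * (m + N.-1))).
    have N1 : (1 < N)%N by rewrite /N ltnS.
    rewrite (eq_bigr _ (fun m _ => congr1 _ (sum_prim_root _ Pw))).
    rewrite (bigD1 (Ordinal N1))//= big1 ?addr0 => [|m m1].
      by rewrite add1n dvdnn muln1 mulrC.
    rewrite (_ : (N %| _)%N = false) ?muln0 ?mulr0//.
    apply/negbTE/negP => /dvdnP[c]; move: m1 (ltn_ord m).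
    rewrite -val_eqE /= /N /= => m1 md mE.
    case: c mE => [|[|c]]; rewrite ?mulSn; lia.
  under eq_bigr do rewrite mulr_sumr.
  rewrite exchange_big /=; apply: eq_bigr => k _.
  rewrite fmorphV rmorph_nat /= mulVKf// (horner_coef_wide _ sq) mulr_sumr.
  apply: eq_bigr => m _; rewrite mulrCA; congr (_ * _).
  by rewrite -exprM -exprD mulnDr addnC.
have p0 : 0 <= p by exact: le_trans ler01 (ltW p1).
have h0 : 0 <= \sum_(k < N) N%:R^-1 * cmod q.[w ^+ k].
  by apply: sumr_ge0 => k _; rewrite mulr_ge0 ?cmod_ge0.
apply: (@le_trans _ _ ((\sum_(k < N) N%:R^-1 * cmod q.[w ^+ k]) `^ p)).
  rewrite ge0_ler_powR ?nnegrE ?cmod_ge0//.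
  rewrite qE (le_trans (cmod_sum _ _))//; apply: ler_sum => k _.
  by rewrite !cmodM wu mul1r cmod_real.
by apply: powR_jensen => // k; exact: cmod_ge0.
Qed.

End circle_averages.

(** * Integrals against densities and product measures *)

Section density.
Local Open Scope ereal_scope.
Context d (T : measurableType d) (R : realType).
Variables (mu nu : {measure set T -> \bar R}) (f : T -> R).
Hypothesis f0 : forall x, (0 <= f x)%R.
Hypothesis mf : measurable_fun setT f.
Hypothesis nuE : forall A, measurable A -> nu A = \int[mu]_(x in A) (f x)%:E.

Import HBNNSimple.

Let mEf : measurable_fun setT (EFin \o f).
Proof. exact/measurable_EFinP. Qed.

Let density_nnsfun (h : {nnsfun T >-> R}) :
  \int[nu]_x (h x)%:E = \int[mu]_x ((h x)%:E * (f x)%:E).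
Proof.
under eq_integral do rewrite fimfunE -fsumEFin//.
rewrite ge0_integral_fsum//; last 2 first.
- by move=> r; exact/measurable_EFinP/measurable_funM.
- by move=> n x _ /=; rewrite EFinM nnfun_muleindic_ge0.
under [RHS]eq_integral.
  move=> x _; rewrite fimfunE -fsumEFin// ge0_mule_fsuml; last first.
    by move=> r; rewrite EFinM nnfun_muleindic_ge0.
  over.
rewrite /= ge0_integral_fsum//; last 2 first.
- move=> r; apply: emeasurable_funM => //.
  exact/measurable_EFinP/measurable_funM.
- by move=> r x _; apply: mule_ge0; rewrite ?EFinM ?nnfun_muleindic_ge0 ?lee_fin.
apply: eq_fsbigr => r /[!inE] -[x _ hx].
have r0 : (0 <= r)%R by rewrite -hx.
under eq_integral do rewrite EFinM.
under [RHS]eq_integral do rewrite EFinM -muleA.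
rewrite !ge0_integralZl//; last 3 first.
- by apply: emeasurable_funM => //; exact/measurable_EFinP.
- by move=> y _; rewrite mule_ge0 ?lee_fin.
- exact/measurable_EFinP.
rewrite integral_indic// setIT nuE//; congr (_ * _).
rewrite integral_mkcond; apply: eq_integral => y _.
by rewrite patchE indicE; case: ifP => _; rewrite ?mul1e ?mul0e.
Qed.

Lemma integral_density (g : T -> \bar R) :
  measurable_fun setT g -> (forall x, 0 <= g x) ->
  \int[nu]_x g x = \int[mu]_x (g x * (f x)%:E).
Proof.
move=> mg g0; pose h := nnsfun_approx measurableT mg.
have gE x : g x = limn (fun n => (h n x)%:E).
  by apply/esym/cvg_lim => //; exact: cvg_nnsfun_approx.
have mh n : measurable_fun setT (fun x => (h n x)%:E) by exact/measurable_EFinP.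
have ndh x : {homo (fun n => (h n x)%:E) : m n / (m <= n)%N >-> m <= n}.
  by move=> m n mn; rewrite lee_fin; exact/lefP/nd_nnsfun_approx.
transitivity (limn (fun n => \int[nu]_x (h n x)%:E)).
  rewrite -monotone_convergence//; first by apply: eq_integral => x _; exact: gE.
  by move=> n x _; rewrite lee_fin.
under eq_fun do rewrite density_nnsfun.
rewrite -monotone_convergence//.
- apply: eq_integral => x _; apply/cvg_lim => //; apply: cvgeZr => //.
  by apply: cvg_nnsfun_approx.
- by move=> n; exact: emeasurable_funM.
- by move=> n x _; rewrite mule_ge0 ?lee_fin.
- by move=> x _ m n mn; rewrite lee_wpmul2r ?lee_fin// -lee_fin ndh.
Qed.

End density.

Section lebesgue_translation.
Local Open Scope ereal_scope.
Variable R : realType.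
Local Notation lam := (@lebesgue_measure R).

Let mtrans (c : R) :
  measurable_fun setT ((fun x => x + c)%R : _ -> measurableTypeR R).
Proof. exact: measurable_funD. Qed.

Lemma lebesgue_translation (c : R) (A : set R) : measurable A ->
  pushforward lam ((fun x => x + c)%R : _ -> measurableTypeR R) A = lam A.
Proof.
move=> mA; apply/esym/lebesgue_measure_unique; [exact: mtrans| |exact: mA].
move=> ? _ [[a b]] _ <-.
rewrite [RHS](_ : _ = lam `](a - c)%R, (b - c)%R]%classic); last first.
  by congr (lam _); apply/seteqP; split => x /=; rewrite !in_itv/= ltrBlDr lerBrDr.
rewrite !lebesgue_measure_itv/= !lte_fin ltrD2r; case: ifP => // _.
by congr (_%:E); ring.
Qed.

Lemma integral_translation (c : R) (g : measurableTypeR R -> \bar R) :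
  measurable_fun setT g -> (forall x, 0 <= g x) ->
  \int[lam]_x g (x + c)%R = \int[lam]_x g x.
Proof.
move=> mg g0.
transitivity (\int[pushforward lam ((fun x => x + c)%R : _ -> measurableTypeR R)]_x g x).
  by rewrite ge0_integral_pushforward ?preimage_setT//; exact: mtrans.
by apply: eq_measure_integral => //= [|? A mA _]; [exact: mtrans|exact: lebesgue_translation].
Qed.

End lebesgue_translation.


Section tonelli.
Local Open Scope ereal_scope.
Context d1 d2 (T1 : measurableType d1) (T2 : measurableType d2) (R : realType).
Variable mu : {sigma_finite_measure set T1 -> \bar R}.
Variable nu : {sigma_finite_measure set T2 -> \bar R}.
Variable f : T1 * T2 -> \bar R.
Hypothesis mf : measurable_fun setT f.
Hypothesis f0 : forall x, 0 <= f x.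

Lemma integral_prod_measure :
  \int[prod_measure mu nu]_u f u = \int[mu]_x \int[nu]_y f (x, y).
Proof. by rewrite /prod_measure fubini_tonelli1. Qed.

Lemma integral_prod_measure2 :
  \int[prod_measure mu nu]_u f u = \int[nu]_y \int[mu]_x f (x, y).
Proof. by rewrite /prod_measure fubini_tonelli2. Qed.

Lemma integral_prod_measureC :
  \int[mu]_x \int[nu]_y f (x, y) = \int[nu]_y \int[mu]_x f (x, y).
Proof. exact: fubini_tonelli. Qed.

Lemma measurable_partial_integral :
  measurable_fun setT (fun x => \int[nu]_y f (x, y)).
Proof. exact: measurable_fun_fubini_tonelli_F. Qed.

End tonelli.


(** * Rotation invariance of the Gaussian measure of the plane *)

Section rotation_invariance.
Local Open Scope ereal_scope.
Variable R : realType.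
Local Notation Rm := (measurableTypeR R).
Local Notation lam := (@lebesgue_measure R).
Local Notation lam2 := (prod_measure lam lam).

Definition std_normal : set Rm -> \bar R := normal_prob 0 1.
HB.instance Definition _ := Measure.on std_normal.
HB.instance Definition _ := Probability.on std_normal.

Definition cgauss := prod_measure std_normal std_normal.
HB.instance Definition _ := SigmaFiniteMeasure.on cgauss.

Definition affine2 (a b c d : R) (u : Rm * Rm) : Rm * Rm :=
  (a * u.1 + b * u.2, c * u.1 + d * u.2)%R.

Lemma measurable_affine2 a b c d : measurable_fun setT (affine2 a b c d).
Proof.
apply: measurable_fun_pair; apply: measurable_funD; apply: measurable_funM => //.
Qed.

Lemma integral_shear1 t (g : Rm * Rm -> \bar R) :
  measurable_fun setT g -> (forall x, 0 <= g x) ->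
  \int[lam2]_u g (affine2 1 t 0 1 u) = \int[lam2]_u g u.
Proof.
move=> mg g0; rewrite !integral_prod_measure2//; last first.
  by apply: measurableT_comp => //; exact: measurable_affine2.
apply: eq_integral => y _.
rewrite -(@integral_translation _ (t * y)%R (fun x => g (x, y)))//.
  by apply: eq_integral => x _; rewrite /affine2/= !mul1r mul0r add0r.
by apply: measurableT_comp => //; exact: pair2_measurable.
Qed.

Lemma integral_shear2 t (g : Rm * Rm -> \bar R) :
  measurable_fun setT g -> (forall x, 0 <= g x) ->
  \int[lam2]_u g (affine2 1 0 t 1 u) = \int[lam2]_u g u.
Proof.
move=> mg g0; rewrite !integral_prod_measure//; last first.
  by apply: measurableT_comp => //; exact: measurable_affine2.
apply: eq_integral => x _.
rewrite -(@integral_translation _ (t * x)%R (fun y => g (x, y)))//.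
  by apply: eq_integral => y _; rewrite /affine2/= !mul1r mul0r addr0 addrC.
by apply: measurableT_comp => //; exact: pair1_measurable.
Qed.

(** With [t = s / (1 + c)], the tangent of half the angle, the rotation is the
product of the shears of parameters [-t], [s] and [-t]. The half-turn, for
which [t] is not defined, is the square of a quarter-turn. *)
Lemma lebesgue_rotation c s (g : Rm * Rm -> \bar R) : (c ^+ 2 + s ^+ 2 = 1)%R ->
  measurable_fun setT g -> (forall x, 0 <= g x) ->
  \int[lam2]_u g (affine2 c (- s) s c u) = \int[lam2]_u g u.
Proof.
move=> cs mg g0.
have mgA a b c' d : measurable_fun setT (g \o affine2 a b c' d).
  by apply: measurableT_comp => //; exact: measurable_affine2.
have rot c' s' : (c' ^+ 2 + s' ^+ 2 = 1)%R -> c' != (-1)%R ->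
    forall h : Rm * Rm -> \bar R, measurable_fun setT h -> (forall x, 0 <= h x) ->
    \int[lam2]_u h (affine2 c' (- s') s' c' u) = \int[lam2]_u h u.
  move=> cs' c1 h mh h0.
  have c10 : (1 + c' != 0)%R by rewrite addrC -[1%R]opprK subr_eq0.
  have mhA a b e d : measurable_fun setT (h \o affine2 a b e d).
    by apply: measurableT_comp => //; exact: measurable_affine2.
  pose t := (s' / (1 + c'))%R.
  have tc : (t * (1 + c') = s')%R by rewrite divfK.
  have ts : (1 - t * s' = c')%R.
    apply: (mulIf c10); rewrite mulrBl mul1r mulrAC tc.
    by clear -cs'; nra.
  transitivity (\int[lam2]_u h (affine2 1 (- t) 0 1
      (affine2 1 0 s' 1 (affine2 1 (- t) 0 1 u)))).
    apply: eq_integral => u _ /=; congr (h _); rewrite /affine2 /=.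
    congr pair.
    - transitivity ((1 - t * s') * u.1 - t * (1 + (1 - t * s')) * u.2)%R.
        by rewrite ts tc; ring.
      by ring.
    - transitivity (s' * u.1 + (1 - t * s') * u.2)%R; first by rewrite ts.
      by ring.
  transitivity (\int[lam2]_u h (affine2 1 (- t) 0 1 (affine2 1 0 s' 1 u))).
    apply: (integral_shear1 (- t)
      (g := fun u => h (affine2 1 (- t) 0 1 (affine2 1 0 s' 1 u)))) => //.
    by apply: (measurableT_comp (mhA _ _ _ _)); exact: measurable_affine2.
  transitivity (\int[lam2]_u h (affine2 1 (- t) 0 1 u)).
    apply: (integral_shear2 s' (g := fun u => h (affine2 1 (- t) 0 1 u))) => //.
    exact: (mhA 1 (- t) 0 1)%R.
  exact: integral_shear1.
have [c1|c1] := eqVneq c (-1)%R; last exact: rot.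
have s0 : s = 0%R.
  apply/eqP; rewrite -sqrf_eq0; move: cs; rewrite c1 sqrrN expr1n; move/eqP.
  by rewrite -subr_eq0 addrAC subrr add0r.
have z1 : (0 ^+ 2 + 1 ^+ 2 = 1 :> R)%R by rewrite expr0n expr1n add0r.
have z0 : 0%R != (-1)%R :> R by rewrite eq_sym oppr_eq0 oner_eq0.
transitivity (\int[lam2]_u g (affine2 0 (- 1) 1 0 u)); last exact: rot.
transitivity (\int[lam2]_u g (affine2 0 (- 1) 1 0 (affine2 0 (- 1) 1 0 u))).
  apply: eq_integral => u _ /=; congr (g _); rewrite /affine2 /= c1 s0.
  by congr pair; ring.
apply: (rot _ _ z1 z0 (fun u => g (affine2 0 (- 1) 1 0 u))) => //.
exact: (mgA 0 (- 1) 1 0)%R.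
Qed.

End rotation_invariance.

Section gaussian_plane.
Local Open Scope ereal_scope.
Variable R : realType.
Local Notation Rm := (measurableTypeR R).
Local Notation lam := (@lebesgue_measure R).
Local Notation lam2 := (prod_measure lam lam).
Local Notation phi := (@normal_pdf R 0 1).

Lemma integral_std_normal (g : Rm -> \bar R) :
  measurable_fun setT g -> (forall x, 0 <= g x) ->
  \int[@std_normal R]_x g x = \int[lam]_x (g x * (phi x)%:E).
Proof.
move=> mg g0; apply: integral_density => //.
- by move=> x; exact: normal_pdf_ge0.
- exact: measurable_normal_pdf.
Qed.

Definition plane_density (u : Rm * Rm) : R := (phi u.1 * phi u.2)%R.

Lemma plane_densityE u :
  plane_density u = ((2 * pi)^-1 * expR (- (u.1 ^+ 2 + u.2 ^+ 2) / 2))%R.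
Proof.
rewrite /plane_density normal_pdfE ?oner_neq0// /normal_fun /normal_peak.
rewrite !subr0 expr1n mul1r mulrACA -expRD -invfM -expr2 sqr_sqrtr; last first.
  by rewrite mulrn_wge0// pi_ge0.
by congr (_^-1 * expR _)%R; [rewrite mulr_natl|rewrite opprD mulrDl].
Qed.

Lemma plane_density_ge0 u : (0 <= plane_density u)%R.
Proof. by rewrite mulr_ge0// normal_pdf_ge0. Qed.

Lemma measurable_plane_density : measurable_fun setT plane_density.
Proof.
apply: measurable_funM; apply: measurableT_comp => //; exact: measurable_normal_pdf.
Qed.

Lemma integral_cgauss (g : Rm * Rm -> \bar R) :
  measurable_fun setT g -> (forall x, 0 <= g x) ->
  \int[@cgauss R]_u g u = \int[lam2]_u (g u * (plane_density u)%:E).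
Proof.
move=> mg g0.
have mgx x : measurable_fun setT (fun y => g (x, y)).
  by apply: measurableT_comp => //; exact: pair1_measurable.
have mE : measurable_fun setT (fun u => (g u * (plane_density u)%:E)).
  apply: emeasurable_funM => //.
  by apply/measurable_EFinP; exact: measurable_plane_density.
rewrite /cgauss integral_prod_measure// integral_std_normal; last 2 first.
- exact: measurable_partial_integral.
- by move=> x; apply: integral_ge0.
rewrite integral_prod_measure//; last first.
  by move=> u; rewrite mule_ge0// lee_fin plane_density_ge0.
apply: eq_integral => x _; rewrite integral_std_normal// muleC.
rewrite -ge0_integralZl//; last 3 first.
- apply: emeasurable_funM => //.
  by apply/measurable_EFinP; exact: measurable_normal_pdf.
- by move=> y _; rewrite mule_ge0// lee_fin normal_pdf_ge0.
- by rewrite lee_fin normal_pdf_ge0.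
apply: eq_integral => y _.
by rewrite muleCA /plane_density EFinM.
Qed.

Lemma cgauss_rotation c s (g : Rm * Rm -> \bar R) : (c ^+ 2 + s ^+ 2 = 1)%R ->
  measurable_fun setT g -> (forall x, 0 <= g x) ->
  \int[@cgauss R]_u g (affine2 c (- s) s c u) = \int[@cgauss R]_u g u.
Proof.
move=> cs mg g0.
have mgA : measurable_fun setT (fun u => g (affine2 c (- s) s c u)).
  by apply: measurableT_comp => //; exact: measurable_affine2.
rewrite !integral_cgauss//.
transitivity (\int[lam2]_u ((fun u => g u * (plane_density u)%:E)
    (affine2 c (- s) s c u))).
  apply: eq_integral => u _; rewrite (plane_densityE u).
  rewrite (plane_densityE (affine2 c (- s) s c u)).
  have -> : (u.1 ^+ 2 + u.2 ^+ 2 =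
      (affine2 c (- s) s c u).1 ^+ 2 + (affine2 c (- s) s c u).2 ^+ 2)%R.
    transitivity ((c ^+ 2 + s ^+ 2) * (u.1 ^+ 2 + u.2 ^+ 2))%R.
      by rewrite cs mul1r.
    by rewrite /affine2/=; ring.
  by [].
apply: lebesgue_rotation => //.
- apply: emeasurable_funM => //.
  by apply/measurable_EFinP; exact: measurable_plane_density.
- by move=> u; rewrite mule_ge0// lee_fin plane_density_ge0.
Qed.

End gaussian_plane.

Ltac solve_measurable :=
  repeat first
    [ exact: measurable_cst | exact: measurable_id
    | exact: measurable_fst | exact: measurable_snd
    | assumption
    | apply: measurable_fun_pair
    | match goal with
      | |- measurable_fun _ (fun p => fst (@?E p)) =>
          apply: (measurableT_comp measurable_fst)
      | |- measurable_fun _ (fun p => snd (@?E p)) =>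
          apply: (measurableT_comp measurable_snd)
      | |- measurable_fun _ (fun p => (_ + _)%R) => apply: measurable_funD
      | |- measurable_fun _ (fun p => (_ * _)%R) => apply: measurable_funM
      end ].


(** * Linear combinations of independent Gaussian vectors *)

Section gaussian_complex.
Local Open Scope ereal_scope.
Variable R : realType.
Local Notation Rm := (measurableTypeR R).
Local Notation C2 := (Rm * Rm)%type.
Local Notation normal := (@std_normal R).
Local Notation gauss := (@cgauss R).

Lemma integral_prob_cst d (T : measurableType d)
    (P : probability T R) (k : \bar R) : \int[P]_x k = k.
Proof. by rewrite (integral_cst P measurableT k) [X in _ * X]probability_setT mule1. Qed.

(** The combination is [r] times the first coordinate of a rotated Gaussian
vector of the plane. *)
Lemma std_normal_comb (al be : R) (h : Rm -> \bar R) :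
  measurable_fun setT h -> (forall x, 0 <= h x) ->
  \int[normal]_x \int[normal]_y h (al * x + be * y)%R =
  \int[normal]_x h (Num.sqrt (al ^+ 2 + be ^+ 2) * x)%R.
Proof.
move=> mh h0; set r := Num.sqrt _.
have rE : (r ^+ 2 = al ^+ 2 + be ^+ 2)%R by rewrite sqr_sqrtr// addr_ge0 ?sqr_ge0.
have [r0|r0] := eqVneq r 0%R.
  have /eqP := rE; rewrite r0 expr0n/= eq_sym paddr_eq0 ?sqr_ge0// !sqrf_eq0.
  move=> /andP[/eqP -> /eqP ->].
  apply: eq_integral => x _; rewrite -[RHS](integral_prob_cst normal).
  by apply: eq_integral => y _; rewrite !mul0r addr0.
have mg : measurable_fun setT (fun u : C2 => h (r * u.1)%R).
  by apply: (measurableT_comp mh); solve_measurable.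
transitivity (\int[gauss]_u h (r * u.1)%R).
  rewrite -(@cgauss_rotation R (al / r) (- (be / r)) (fun u => h (r * u.1)%R))//.
    rewrite integral_prod_measure//.
      apply: eq_integral => x _; apply: eq_integral => y _.
      by rewrite /affine2 /= opprK; congr h; field.
    apply: (measurableT_comp mh); rewrite /affine2/=; solve_measurable.
  by rewrite sqrrN !expr_div_n -mulrDl -rE divff// sqrf_eq0.
rewrite integral_prod_measure//; apply: eq_integral => x _ /=.
exact: integral_prob_cst.
Qed.

(** Multiplication by the complex number [a]. The plane is kept as pairs of
reals, which is where its product measure lives. *)
Definition plane_mul (a : R[i]) (u : C2) : C2 :=
  affine2 (complex.Re a) (- complex.Im a) (complex.Im a) (complex.Re a) u.
Definition plane_add (u v : C2) : C2 := (u.1 + v.1, u.2 + v.2)%R.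

Lemma measurable_plane_mul d (T : measurableType d) (a : R[i]) (f : T -> C2) :
  measurable_fun setT f -> measurable_fun setT (fun x => plane_mul a (f x)).
Proof. by move=> mf; apply: measurableT_comp => //; exact: measurable_affine2. Qed.

Lemma measurable_plane_add d (T : measurableType d) (f g : T -> C2) :
  measurable_fun setT f -> measurable_fun setT g ->
  measurable_fun setT (fun x => plane_add (f x) (g x)).
Proof. by move=> mf mg; rewrite /plane_add; solve_measurable. Qed.

(** The argument of [a] acts as a rotation of the plane. *)
Lemma cgauss_phase (a : R[i]) (g : C2 -> \bar R) :
  measurable_fun setT g -> (forall x, 0 <= g x) ->
  \int[gauss]_u g (plane_mul a u) = \int[gauss]_u g (plane_mul (cmod a)%:C%C u).
Proof.
move=> mg g0; set r := cmod a.
have rE : (r ^+ 2 = complex.Re a ^+ 2 + complex.Im a ^+ 2)%R.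
  rewrite /r /cmod; case: (a) => x y /=.
  by rewrite sqr_sqrtr// addr_ge0 ?sqr_ge0.
have [r0|r0] := eqVneq r 0%R.
  have /eqP := rE; rewrite r0 expr0n/= eq_sym paddr_eq0 ?sqr_ge0// !sqrf_eq0.
  move=> /andP[/eqP ra /eqP ia].
  by apply: eq_integral => u _; rewrite /plane_mul /= ra ia.
rewrite -(@cgauss_rotation R (complex.Re a / r) (complex.Im a / r)
  (fun u => g (plane_mul r%:C%C u)))//.
- apply: eq_integral => u _; congr g; rewrite /plane_mul /affine2 /=.
  by congr pair; field.
- by rewrite !expr_div_n -mulrDl -rE divff// sqrf_eq0.
- by apply: (measurableT_comp mg); apply: measurable_plane_mul; exact: measurable_id.
Qed.

(** For real coefficients the two coordinates decouple: after exchanging the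
middle integrals, each is a one-dimensional combination. *)
Lemma cgauss_comb_real (al be : R) (g : C2 -> \bar R) :
  measurable_fun setT g -> (forall x, 0 <= g x) ->
  \int[gauss]_z \int[gauss]_w g (al * z.1 + be * w.1, al * z.2 + be * w.2)%R =
  \int[gauss]_z g (plane_mul (Num.sqrt (al ^+ 2 + be ^+ 2))%:C%C z).
Proof.
move=> mg g0; set r := Num.sqrt _.
have i0 d (T : measurableType d) (m : {measure set T -> \bar R}) (G : T -> C2) :
  0 <= \int[m]_x g (G x) by apply: integral_ge0.
rewrite integral_prod_measure//; last first.
  apply: (measurable_partial_integral _ (f := fun p : C2 * C2 =>
    g (al * p.1.1 + be * p.2.1, al * p.1.2 + be * p.2.2)%R))  => //.
  by apply: (measurableT_comp mg); solve_measurable.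
transitivity (\int[normal]_x1 \int[normal]_x2 \int[normal]_y1 \int[normal]_y2
   g (al * x1 + be * x2, al * y1 + be * y2)%R).
  apply: eq_integral => x1 _.
  rewrite -(integral_prod_measureC _ _ (f := fun p : C2 =>
    \int[normal]_y2 g (al * x1 + be * p.2, al * p.1 + be * y2)%R))//.
    apply: eq_integral => y1 _.
    rewrite integral_prod_measure//.
    by apply: (measurableT_comp mg); solve_measurable.
  apply: (measurable_partial_integral _ (f := fun p : C2 * Rm =>
    g (al * x1 + be * p.1.2, al * p.1.1 + be * p.2)%R))  => //.
  by apply: (measurableT_comp mg); solve_measurable.
pose H t := \int[normal]_y g (t, r * y)%R.
transitivity (\int[normal]_x1 \int[normal]_x2 H (al * x1 + be * x2)%R).
  apply: eq_integral => x1 _; apply: eq_integral => x2 _.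
  rewrite (std_normal_comb al be (h := fun y => g (_, y)))//.
  by apply: (measurableT_comp mg); solve_measurable.
rewrite std_normal_comb; last 2 first.
- apply: (measurable_partial_integral _ (f := fun p : C2 => g (p.1, r * p.2)%R)) => //.
  by apply: (measurableT_comp mg); solve_measurable.
- by move=> x; exact: i0.
transitivity (\int[normal]_x \int[normal]_y g (plane_mul r%:C%C (x, y))).
  apply: eq_integral => x _; apply: eq_integral => y _.
  by rewrite /plane_mul /affine2 /= oppr0 !mul0r addr0 add0r.
apply/esym; apply: (integral_prod_measure _ _ (f := fun z => g (plane_mul r%:C%C z))) => //.
by apply: (measurableT_comp mg); apply: measurable_plane_mul; exact: measurable_id.
Qed.

(** Remove the phases of [a] and [b], one integral at a time. *)
Lemma cgauss_comb (a b : R[i]) (g : C2 -> \bar R) :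
  measurable_fun setT g -> (forall x, 0 <= g x) ->
  \int[gauss]_z \int[gauss]_w g (plane_add (plane_mul a z) (plane_mul b w)) =
  \int[gauss]_z g (plane_mul (Num.sqrt (cmod a ^+ 2 + cmod b ^+ 2))%:C%C z).
Proof.
move=> mg g0.
transitivity (\int[gauss]_z \int[gauss]_w
    g (cmod a * z.1 + cmod b * w.1, cmod a * z.2 + cmod b * w.2)%R); last first.
  exact: cgauss_comb_real.
have mG (a' b' : R[i]) : measurable_fun setT (fun p : C2 * C2 =>
    g (plane_add (plane_mul a' p.1) (plane_mul b' p.2))).
  apply: (measurableT_comp mg); apply: measurable_plane_add; apply: measurable_plane_mul;
  solve_measurable.
transitivity (\int[gauss]_z \int[gauss]_w
    g (plane_add (plane_mul a z) (plane_mul (cmod b)%:C%C w))).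
  apply: eq_integral => z _.
  apply: (cgauss_phase b (g := fun u => g (plane_add (plane_mul a z) u))) => //.
  by apply: (measurableT_comp mg); apply: measurable_plane_add; solve_measurable.
transitivity (\int[gauss]_w \int[gauss]_z
    g (plane_add (plane_mul a z) (plane_mul (cmod b)%:C%C w))).
  exact: (integral_prod_measureC _ _ (mG _ _)).
transitivity (\int[gauss]_w \int[gauss]_z
    g (plane_add (plane_mul (cmod a)%:C%C z) (plane_mul (cmod b)%:C%C w))).
  apply: eq_integral => w _ /=.
  apply: (cgauss_phase a (g := fun u => g (plane_add u (plane_mul (cmod b)%:C%C w)))) => //.
  by apply: (measurableT_comp mg); apply: measurable_plane_add; solve_measurable.
transitivity (\int[gauss]_z \int[gauss]_w
    g (plane_add (plane_mul (cmod a)%:C%C z) (plane_mul (cmod b)%:C%C w))).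
  by apply/esym; exact: (integral_prod_measureC _ _ (mG _ _)).
apply: eq_integral => z _; apply: eq_integral => w _.
by rewrite /plane_mul /plane_add /affine2 /= !oppr0 !mul0r !addr0 !add0r.
Qed.

End gaussian_complex.

Section power_integral.
Local Open Scope ereal_scope.
Context d (T : measurableType d) (R : realType).
Variable mu : {sigma_finite_measure set T -> \bar R}.

Lemma integral_power_measureS n (g : n.+1.-tuple T -> \bar R) :
  measurable_fun setT g -> (forall x, 0 <= g x) ->
  \int[power_measure mu n.+1]_w g w =
  \int[mu]_u \int[power_measure mu n]_t g (tcons (u, t)).
Proof.
move=> mg g0 /=; rewrite /power_measureS.
transitivity (\int[prod_measure mu (power_measure mu n)]_x g (tcons x)).
  rewrite ge0_integral_pushforward ?preimage_setT//.
  exact: measurable_tcons.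
apply: (integral_prod_measure _ _ (f := fun x => g (tcons x))) => //.
by apply: (measurableT_comp mg); exact: measurable_tcons.
Qed.

Lemma integral_power_measure0 (g : 0.-tuple T -> \bar R) :
  measurable_fun setT g ->
  \int[power_measure mu 0]_w g w = g [tuple].
Proof. by move=> mg /=; rewrite integral_dirac// diracT mul1e. Qed.

Lemma measurable_tcons_comp d' (X : measurableType d') n (f : X -> T)
    (h : X -> n.-tuple T) : measurable_fun setT f -> measurable_fun setT h ->
  measurable_fun setT (fun x => tcons (f x, h x)).
Proof. by move=> mf mh; exact: measurable_cons. Qed.

Lemma tnth_tcons0 n (u : T) (t : n.-tuple T) : tnth (tcons (u, t)) ord0 = u.
Proof. by []. Qed.

Lemma tnth_tconsS n (u : T) (t : n.-tuple T) j :
  tnth (tcons (u, t)) (lift ord0 j) = tnth t j.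
Proof. by rewrite tnthS. Qed.

End power_integral.

Section gaussian_power.
Local Open Scope ereal_scope.
Variable R : realType.
Local Notation Rm := (measurableTypeR R).
Local Notation C2 := (Rm * Rm)%type.
Local Notation lam := (@lebesgue_measure R).
Local Notation gauss := (@cgauss R).

Definition gaussn (n : nat) := power_measure gauss n.

Lemma gaussian_density_tcons n (u : C2) (t : n.-tuple C2) :
  @gaussian_density R n.+1 (tcons (u, t)) =
  (plane_density u * @gaussian_density R n t)%R.
Proof.
rewrite (plane_densityE u) /gaussian_density.
have normE m (w : R2n R m) : (euclidean_norm w ^+ 2 =
    \sum_(j < m) (xcoord w j ^+ 2 + ycoord w j ^+ 2))%R.
  by rewrite sqr_sqrtr// sumr_ge0// => j _; rewrite addr_ge0 ?sqr_ge0.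
rewrite !normE big_ord_recl /= mulrACA -expRD -invfM -exprS.
congr (_ * expR _)%R; rewrite -mulrDl -opprD; congr (- _ / _)%R.
congr (_ + _)%R; apply: eq_bigr => j _.
by rewrite /xcoord /ycoord tnth_tconsS.
Qed.

(** The Gaussian density factors over the coordinates. *)
Lemma integral_lebesgue_power n (g : n.-tuple C2 -> \bar R) :
  measurable_fun setT g -> (forall x, 0 <= g x) ->
  \int[lebesgue_R2n R n]_w (g w * (@gaussian_density R n w)%:E) =
  \int[gaussn n]_w g w.
Proof.
elim: n g => [|n IH] g mg g0.
  rewrite [LHS]integral_power_measure0 ?[RHS]integral_power_measure0//; last first.
    apply: emeasurable_funM => //; apply/measurable_EFinP.
    exact: measurable_gaussian_density.
  rewrite /gaussian_density /euclidean_norm big_ord0 sqrtr0 expr0 expr0n /= oppr0.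
  by rewrite mul0r expR0 invr1 mulr1 mule1.
have mgd : measurable_fun setT (fun w => g w * (@gaussian_density R n.+1 w)%:E).
  apply: emeasurable_funM => //; apply/measurable_EFinP.
  exact: measurable_gaussian_density.
have mgt u : measurable_fun setT (fun t => g (tcons (u, t))).
  by apply: (measurableT_comp mg); apply: measurable_tcons_comp.
transitivity (\int[prod_measure lam lam]_u \int[lebesgue_R2n R n]_t
    (g (tcons (u, t)) * (@gaussian_density R n.+1 (tcons (u, t)))%:E)).
  apply: (integral_power_measureS _ mgd) => w.
  by rewrite mule_ge0// lee_fin gaussian_density_ge0.
transitivity (\int[prod_measure lam lam]_u
   ((\int[gaussn n]_t g (tcons (u, t))) * (plane_density u)%:E)).
  apply: eq_integral => u _; rewrite -IH// muleC -ge0_integralZl//; last 3 first.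
  - apply: emeasurable_funM => //; apply/measurable_EFinP.
    exact: measurable_gaussian_density.
  - by move=> t _; rewrite mule_ge0// lee_fin gaussian_density_ge0.
  - by rewrite lee_fin plane_density_ge0.
  apply: eq_integral => t _.
  by rewrite gaussian_density_tcons EFinM muleCA.
transitivity (\int[gauss]_u \int[gaussn n]_t g (tcons (u, t))).
  apply/esym; apply: integral_cgauss.
    apply: (measurable_partial_integral _ (f := fun p => g (tcons p))) => //.
    by apply: (measurableT_comp mg); exact: measurable_tcons.
  by move=> u; exact: integral_ge0.
by apply/esym; exact: integral_power_measureS.
Qed.

Lemma integral_gaussian_measure n (g : n.-tuple C2 -> \bar R) :
  measurable_fun setT g -> (forall x, 0 <= g x) ->
  \int[@gaussian_measure R n]_w g w = \int[gaussn n]_w g w.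
Proof.
move=> mg g0; rewrite -integral_lebesgue_power//.
apply: integral_density => //.
- exact: gaussian_density_ge0.
- exact: measurable_gaussian_density.
Qed.

Definition tscale n (a : R[i]) (z : n.-tuple C2) : n.-tuple C2 :=
  [tuple plane_mul a (tnth z j) | j < n].

Definition tadd n (z w : n.-tuple C2) : n.-tuple C2 :=
  [tuple plane_add (tnth z j) (tnth w j) | j < n].

Lemma measurable_tnth_comp d (X : measurableType d) n (f : X -> n.-tuple C2) j :
  measurable_fun setT f -> measurable_fun setT (fun x => tnth (f x) j).
Proof.
move=> mf; apply: (@measurableT_comp _ _ _ _ _ _ (fun z => tnth z j)) => //.
exact: measurable_tnth.
Qed.

Lemma measurable_tscale d (X : measurableType d) n a (f : X -> n.-tuple C2) :
  measurable_fun setT f -> measurable_fun setT (fun x => tscale a (f x)).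
Proof.
move=> mf; apply/measurable_fun_tnthP => j.
rewrite (_ : _ \o _ = fun x => plane_mul a (tnth (f x) j)); last first.
  by apply/funext => x; rewrite /= tnth_mktuple.
by apply: measurable_plane_mul; exact: measurable_tnth_comp.
Qed.

Lemma measurable_tadd d (X : measurableType d) n (f h : X -> n.-tuple C2) :
  measurable_fun setT f -> measurable_fun setT h ->
  measurable_fun setT (fun x => tadd (f x) (h x)).
Proof.
move=> mf mh; apply/measurable_fun_tnthP => j.
rewrite (_ : _ \o _ = fun x => plane_add (tnth (f x) j) (tnth (h x) j)); last first.
  by apply/funext => x; rewrite /= tnth_mktuple.
by apply: measurable_plane_add; exact: measurable_tnth_comp.
Qed.

Lemma tscale_tcons n a u (t : n.-tuple C2) :
  tscale a (tcons (u, t)) = tcons (plane_mul a u, tscale a t).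
Proof.
apply: eq_from_tnth => j; rewrite tnth_mktuple.
case: (unliftP ord0 j) => [i ->|->]; last by rewrite !tnth_tcons0.
by rewrite !tnth_tconsS tnth_mktuple.
Qed.

Lemma tadd_tcons n u v (t s : n.-tuple C2) :
  tadd (tcons (u, t)) (tcons (v, s)) = tcons (plane_add u v, tadd t s).
Proof.
apply: eq_from_tnth => j; rewrite tnth_mktuple.
case: (unliftP ord0 j) => [i ->|->]; last by rewrite !tnth_tcons0.
by rewrite !tnth_tconsS tnth_mktuple.
Qed.

(** The law of [a z + b w] for independent standard Gaussian vectors [z] and
[w]. By induction on the dimension: Tonelli's theorem gathers the integrals
over the first coordinates, which are handled by the planar case. *)
Lemma gaussn_comb n (a b : R[i]) (g : n.-tuple C2 -> \bar R) :
  measurable_fun setT g -> (forall x, 0 <= g x) ->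
  \int[gaussn n]_z \int[gaussn n]_w g (tadd (tscale a z) (tscale b w)) =
  \int[gaussn n]_z g (tscale (Num.sqrt (cmod a ^+ 2 + cmod b ^+ 2))%:C%C z).
Proof.
elim: n g => [|n IH] g mg g0.
  have e (x y : 0.-tuple C2) : x = y by rewrite [x]tuple0 [y]tuple0.
  rewrite [RHS]integral_power_measure0; last first.
    by apply: (measurableT_comp mg); apply: measurable_tscale; exact: measurable_id.
  under eq_integral => z _.
    rewrite integral_power_measure0; last first.
      apply: (measurableT_comp mg); apply: measurable_tadd; apply: measurable_tscale.
      - exact: measurable_cst.
      - exact: measurable_id.
    over.
  rewrite [LHS]integral_power_measure0; first by congr g; exact: e.
  apply: (measurableT_comp mg); apply: measurable_tadd; apply: measurable_tscale.
  - exact: measurable_id.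
  - exact: measurable_cst.
set r := Num.sqrt _ in IH *.
have mG d (X : measurableType d) (f h : X -> n.+1.-tuple C2) :
    measurable_fun setT f -> measurable_fun setT h ->
    measurable_fun setT (fun x => g (tadd (tscale a (f x)) (tscale b (h x)))).
  move=> mf mh; apply: (measurableT_comp mg); apply: measurable_tadd;
  exact: measurable_tscale.
have i0 d (X : measurableType d) (m : {measure set X -> \bar R}) (G : X -> \bar R) :
  (forall x, 0 <= G x) -> 0 <= \int[m]_x G x by move=> ?; apply: integral_ge0.
transitivity (\int[gauss]_u \int[gaussn n]_t \int[gauss]_v \int[gaussn n]_s
    g (tadd (tscale a (tcons (u, t))) (tscale b (tcons (v, s))))).
  transitivity (\int[gauss]_u \int[gaussn n]_t \int[gaussn n.+1]_w
      g (tadd (tscale a (tcons (u, t))) (tscale b w))).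
    apply: (integral_power_measureS _ (g := fun z => \int[gaussn n.+1]_w
      g (tadd (tscale a z) (tscale b w)))) => [|x]; last exact: i0.
    apply: (measurable_partial_integral _ (f := fun p =>
      g (tadd (tscale a p.1) (tscale b p.2)))) => //.
    exact: mG.
  apply: eq_integral => u _; apply: eq_integral => t _.
  apply: (integral_power_measureS _ (g := fun w =>
      g (tadd (tscale a (tcons (u, t))) (tscale b w)))) => //.
  exact: mG.
transitivity (\int[gauss]_u \int[gauss]_v \int[gaussn n]_t \int[gaussn n]_s
    g (tadd (tscale a (tcons (u, t))) (tscale b (tcons (v, s))))).
  apply: eq_integral => u _.
  apply: (integral_prod_measureC _ _ (f := fun p : n.-tuple C2 * C2 => \int[gaussn n]_s
    g (tadd (tscale a (tcons (u, p.1))) (tscale b (tcons (p.2, s)))))) => [|x]; last exact: i0.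
  apply: (measurable_partial_integral _ (f := fun p : (n.-tuple C2 * C2) * n.-tuple C2 =>
    g (tadd (tscale a (tcons (u, p.1.1))) (tscale b (tcons (p.1.2, p.2)))))) => //.
  by apply: mG; apply: measurable_tcons_comp; solve_measurable.
pose H (c : C2) := \int[gaussn n]_t g (tcons (c, tscale r%:C%C t)).
transitivity (\int[gauss]_u \int[gauss]_v H (plane_add (plane_mul a u) (plane_mul b v))).
  apply: eq_integral => u _; apply: eq_integral => v _.
  rewrite /H -(IH (fun t => g (tcons (plane_add (plane_mul a u) (plane_mul b v), t))))//.
    apply: eq_integral => t _; apply: eq_integral => s _.
    by rewrite !tscale_tcons tadd_tcons.
  apply: (measurableT_comp mg); apply: measurable_tcons_comp; solve_measurable.
transitivity (\int[gauss]_u H (plane_mul r%:C%C u)).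
  apply: cgauss_comb => [|x]; last exact: i0.
  apply: (measurable_partial_integral _ (f := fun p =>
    g (tcons (p.1, tscale r%:C%C p.2)))) => //.
  apply: (measurableT_comp mg); apply: measurable_tcons_comp => //.
  exact: measurable_tscale.
transitivity (\int[gauss]_u \int[gaussn n]_t g (tscale r%:C%C (tcons (u, t)))).
  apply: eq_integral => u _; apply: eq_integral => t _.
  by rewrite tscale_tcons.
apply/esym; apply: (integral_power_measureS _ (g := fun w => g (tscale r%:C%C w))) => //.
by apply: (measurableT_comp mg); apply: measurable_tscale; exact: measurable_id.
Qed.

Lemma gaussn_phase n (a : R[i]) (g : n.-tuple C2 -> \bar R) :
  cmod a = 1%R -> measurable_fun setT g -> (forall x, 0 <= g x) ->
  \int[gaussn n]_z g (tscale a z) = \int[gaussn n]_z g z.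
Proof.
move=> a1; elim: n g => [|n IH] g mg g0.
  by apply: eq_integral => z _; congr g; rewrite [LHS]tuple0 [RHS]tuple0.
transitivity (\int[gauss]_u \int[gaussn n]_t g (tscale a (tcons (u, t)))).
  apply: (integral_power_measureS _ (g := fun w => g (tscale a w))) => //.
  by apply: (measurableT_comp mg); apply: measurable_tscale; exact: measurable_id.
transitivity (\int[gauss]_u \int[gaussn n]_t g (tcons (plane_mul a u, t))).
  apply: eq_integral => u _.
  rewrite -(IH (fun t => g (tcons (plane_mul a u, t))))//.
    by apply: eq_integral => t _; rewrite tscale_tcons.
  by apply: (measurableT_comp mg); apply: measurable_tcons_comp; solve_measurable.
transitivity (\int[gauss]_u \int[gaussn n]_t g (tcons (u, t))); last first.
  by apply/esym; exact: integral_power_measureS.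
transitivity (\int[gauss]_u \int[gaussn n]_t g (tcons (plane_mul (cmod a)%:C%C u, t))).
  apply: (cgauss_phase a (g := fun u => \int[gaussn n]_t g (tcons (u, t)))).
    apply: (measurable_partial_integral _ (f := fun p => g (tcons p))) => //.
    by apply: (measurableT_comp mg); exact: measurable_tcons.
  by move=> u; exact: integral_ge0.
apply: eq_integral => u _; apply: eq_integral => t _; congr (g (tcons (_, _))).
rewrite a1 /plane_mul /affine2 /= oppr0 !mul0r !mul1r addr0 add0r.
by case: (u).
Qed.

Definition tdot n (c : 'I_n -> R[i]) (w : n.-tuple C2) : C2 :=
  (\sum_(j < n) (plane_mul (c j) (tnth w j)).1,
   \sum_(j < n) (plane_mul (c j) (tnth w j)).2)%R.

Lemma measurable_tdot n c : measurable_fun setT (@tdot n c).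
Proof.
apply: measurable_fun_pair; apply: measurable_sum => j.
- apply: (measurableT_comp measurable_fst); apply: measurable_plane_mul.
  exact: measurable_tnth.
- apply: (measurableT_comp measurable_snd); apply: measurable_plane_mul.
  exact: measurable_tnth.
Qed.

(** A linear form in a Gaussian vector is a complex Gaussian variable, scaled
by the Hermitian norm of its coefficients: adding one coordinate is a
combination of two independent Gaussian variables. *)
Lemma gaussn_tdot n (c : 'I_n -> R[i]) (h : C2 -> \bar R) :
  measurable_fun setT h -> (forall x, 0 <= h x) ->
  \int[gaussn n]_w h (tdot c w) =
  \int[gauss]_u h (plane_mul (Num.sqrt (\sum_(j < n) cmod (c j) ^+ 2))%:C%C u).
Proof.
elim: n c h => [|n IH] c h mh h0.
  rewrite [LHS]integral_power_measure0; last first.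
    by apply: (measurableT_comp mh); exact: measurable_tdot.
  have z0 (u : C2) : plane_mul (Num.sqrt (\sum_(j < 0) cmod (c j) ^+ 2))%:C%C u = (0, 0)%R.
    by rewrite big_ord0 sqrtr0 /plane_mul /affine2 /= oppr0 !mul0r addr0.
  transitivity (\int[gauss]_u h (0, 0)%R).
    rewrite /tdot !big_ord0.
    transitivity (\int[@std_normal R]_x \int[@std_normal R]_y h (0, 0)%R).
      by rewrite !integral_prob_cst.
    by apply/esym; apply: (integral_prod_measure _ _ (f := fun=> h (0, 0)%R)) => //;
      exact: measurable_cst.
  by apply: eq_integral => u _; rewrite z0.
set r := Num.sqrt _.
pose c' j := c (lift ord0 j).
pose r' := Num.sqrt (\sum_(j < n) cmod (c' j) ^+ 2).
have tdotE u t : tdot c (tcons (u, t)) = plane_add (plane_mul (c ord0) u) (tdot c' t).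
  rewrite /tdot /plane_add !big_ord_recl !tnth_tcons0; congr (_ + _, _ + _)%R;
  by apply: eq_bigr => j _; rewrite tnth_tconsS.
transitivity (\int[gauss]_u \int[gaussn n]_t h (plane_add (plane_mul (c ord0) u) (tdot c' t))).
  transitivity (\int[gauss]_u \int[gaussn n]_t h (tdot c (tcons (u, t)))).
    apply: (integral_power_measureS _ (g := fun w => h (tdot c w))) => //.
    by apply: (measurableT_comp mh); exact: measurable_tdot.
  by apply: eq_integral => u _; apply: eq_integral => t _; rewrite tdotE.
transitivity (\int[gauss]_u \int[gauss]_v h (plane_add (plane_mul (c ord0) u) (plane_mul r'%:C%C v))).
  apply: eq_integral => u _.
  apply: (IH c' (fun v => h (plane_add (plane_mul (c ord0) u) v))) => //.
  by apply: (measurableT_comp mh); apply: measurable_plane_add; solve_measurable.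
have -> : r = Num.sqrt (cmod (c ord0) ^+ 2 + cmod r'%:C%C ^+ 2).
  rewrite cmod_real ?sqrtr_ge0// [in RHS]sqr_sqrtr; last first.
    by rewrite sumr_ge0// => j _; rewrite sqr_ge0.
  by rewrite /r big_ord_recl.
exact: cgauss_comb.
Qed.

End gaussian_power.

(** * Analytic polynomials on complex lines *)

Section line_restriction.
Variables (n : nat) (R : comNzRingType).
Implicit Types (P Q : mpoly n R) (z v : 'I_n -> R).

Definition line_poly z v P : {poly R} :=
  mmap polyC (fun j => (z j)%:P + v j *: 'X) P.

Lemma horner_line_poly z v P t :
  (line_poly z v P).[t] = meval (fun j => z j + v j * t) P.
Proof.
rewrite /line_poly /meval /mmap horner_sum; apply: eq_bigr => m _.
rewrite hornerM hornerC /=; congr (_ * _); rewrite /mmap1 horner_prod.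
by apply: eq_bigr => j _; rewrite horner_exp !hornerE.
Qed.

Lemma line_polyM z v P Q : line_poly z v (P * Q) = line_poly z v P * line_poly z v Q.
Proof. by rewrite /line_poly rmorphM. Qed.

Lemma line_poly_coef0 z v P : (line_poly z v P)`_0 = meval z P.
Proof.
rewrite -horner_coef0 horner_line_poly.
by apply: meval_eq => j; rewrite mulr0 addr0.
Qed.

(** The chain rule at [t = 0]. Both sides are additive and obey the Leibniz
rule, so that it is enough to check constants and variables. *)
Lemma line_poly_coef1 z v P :
  (line_poly z v P)`_1 = \sum_(j < n) v j * meval z (mderiv j P).
Proof.
pose chain Q := (line_poly z v Q)`_1 = \sum_(j < n) v j * meval z (mderiv j Q).
have chainM Q1 Q2 : chain Q1 -> chain Q2 -> chain (Q1 * Q2).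
  rewrite /chain line_polyM coefM 2!big_ord_recl big_ord0 addr0 /= => -> ->.
  rewrite !line_poly_coef0 mulr_sumr mulr_suml -big_split /=.
  by apply: eq_bigr => j _; rewrite mderivM mevalD !mevalM; ring.
have chainC c : chain (mpolyC n c).
  rewrite /chain /line_poly mmapC coefC /= big1// => j _.
  by rewrite mderivC meval0 mulr0.
have chainX i : chain (mpolyX R (mnm1 i)).
  rewrite /chain /line_poly mmapX mmap1U coefD coefC coefZ coefX /= add0r mulr1.
  rewrite (bigD1 i)//= big1 ?addr0 => [|j ji]; rewrite mderivX mnm1E mevalZ.
    by rewrite eqxx mevalX big1 ?mulr1// => j _; rewrite mnmBE subnn expr0.
  by rewrite eq_sym (negbTE ji) mul0r mulr0.
rewrite -/(chain P) (mpolyE P).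
apply: (big_ind chain) => [|Q1 Q2 h1 h2|m _].
- by rewrite -(mpolyC0 n R).
- rewrite /chain /line_poly mmapD coefD h1 h2 -big_split /=.
  by apply: eq_bigr => j _; rewrite mderivD mevalD mulrDr.
- rewrite -mul_mpolyC mpolyXE_id; apply: (chainM _ _ (chainC _)).
  apply: (big_ind chain) => [||i _]; [exact: (chainC 1)|exact: chainM|].
  elim: (m i) => [|k ih]; first by rewrite expr0; exact: (chainC 1).
  by rewrite exprS; exact: chainM.
Qed.

Lemma size_line_poly z v P : (size (line_poly z v P) <= mmeasure mdeg P)%N.
Proof.
rewrite /line_poly /mmap (leq_trans (size_sum _ _ _))//.
apply/bigmax_leqP_seq => m mP _; apply: (leq_trans _ (msize_mdeg_lt mP)).
rewrite mul_polyC (leq_trans (size_scale_leq _ _))// /mmap1 mdegE.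
elim/big_ind2 : _ => [|p1 k1 p2 k2 h1 h2|i _]; first by rewrite size_poly1.
  by rewrite (leq_trans (size_polyMleq _ _))//; lia.
elim: (m i) => [|k ih]; first by rewrite expr0 size_poly1.
rewrite exprS (leq_trans (size_polyMleq _ _))//.
suff : (size ((z i)%:P + v i *: 'X)%R <= 2)%N by lia.
rewrite (leq_trans (size_polyD _ _))// geq_max (leq_trans (size_polyC_leq1 _))//=.
by rewrite (leq_trans (size_scale_leq _ _))// size_polyX.
Qed.

End line_restriction.

Lemma poly_eq_on_nat (F : numDomainType) (p q : {poly F}) :
  (forall k : nat, p.[k%:R] = q.[k%:R]) -> p = q.
Proof.
move=> pq; apply/eqP; rewrite -subr_eq0; apply/negP => /negP pq0.
pose rs : seq F := [seq k%:R | k <- iota 0 (size (p - q))].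
suff : (size rs < size (p - q)%R)%N by rewrite size_map size_iota ltnn.
apply: max_poly_roots => //.
  by apply/allP => _ /mapP[k _ ->]; rewrite rootE !hornerE pq subrr.
by rewrite map_inj_uniq ?iota_uniq//; exact: mulrIn (oner_neq0 _).
Qed.

Section analytic_derivatives.
Variable R : realType.

Lemma Re_horner (q : {poly R[i]}) (t : R) :
  complex.Re q.[t%:C%C] = (\poly_(k < size q) complex.Re q`_k).[t].
Proof.
rewrite horner_coef horner_poly raddf_sum; apply: eq_bigr => k _ /=.
by rewrite -rmorphXn /=; case: (q`_k) => a b /=; rewrite mulr0 subr0.
Qed.

Lemma Im_horner (q : {poly R[i]}) (t : R) :
  complex.Im q.[t%:C%C] = (\poly_(k < size q) complex.Im q`_k).[t].
Proof.
rewrite horner_coef horner_poly raddf_sum; apply: eq_bigr => k _ /=.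
by rewrite -rmorphXn /=; case: (q`_k) => a b /=; rewrite mulr0 add0r.
Qed.

Lemma derive1_shifted_horner (q : {poly R}) (c : R) :
  ((fun t => q.[t - c])^`()%classic) c = q`_1.
Proof.
rewrite (_ : (fun t => q.[t - c]) = horner (q \Po ('X - c%:P))).
  rewrite -derivE deriv_comp derivXsubC mulr1 horner_comp !hornerE subrr.
  by rewrite horner_coef0 coef_deriv.
by apply/funext => t; rewrite horner_comp !hornerE.
Qed.

(** Along a real parameter, the real and imaginary parts of a complex
polynomial are the real polynomials of the parts of its coefficients. *)
Lemma cderive1_horner (q : {poly R[i]}) (c : R) :
  cderive1 (fun t => q.[(t - c)%:C%C]) c = q`_1.
Proof.
rewrite /cderive1.
have -> : (fun t => complex.Re q.[(t - c)%:C%C]) =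
    (fun t => (\poly_(k < size q) complex.Re q`_k).[t - c]).
  by apply/funext => t; rewrite Re_horner.
have -> : (fun t => complex.Im q.[(t - c)%:C%C]) =
    (fun t => (\poly_(k < size q) complex.Im q`_k).[t - c]).
  by apply/funext => t; rewrite Im_horner.
rewrite !derive1_shifted_horner !coef_poly; have [q1|q1] := ltnP.
  by case: (q`_1).
by rewrite nth_default.
Qed.

Variables (n : nat) (P : mpoly n R[i]).
Variable f : ('I_n -> R[i]) -> R[i].
Hypothesis fP : forall z, f z = meval z P.

Lemma meval_line (z v z' : 'I_n -> R[i]) (q : {poly R[i]}) t :
  q = line_poly z v P -> (forall j, z' j = z j + v j * t) -> f z' = q.[t].
Proof. by move=> -> h; rewrite fP horner_line_poly; exact: meval_eq. Qed.

Let basis (j : 'I_n) (c : R[i]) (k : 'I_n) : R[i] := if k == j then c else 0.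

Let coef1_basis z j c :
  (line_poly z (basis j c) P)`_1 = c * meval z (mderiv j P).
Proof.
rewrite line_poly_coef1 (bigD1 j)//= /basis eqxx big1 ?addr0// => k kj.
by rewrite (negbTE kj) mul0r.
Qed.

Lemma partial_xE w j :
  partial_x (on_R2n f) j w = meval (complex_point w) (mderiv j P).
Proof.
rewrite /partial_x.
rewrite (_ : (fun t => _) = fun t =>
    (line_poly (complex_point w) (basis j 1) P).[(t - xcoord w j)%:C%C]).
  by rewrite cderive1_horner coef1_basis mul1r.
apply/funext => t; rewrite /on_R2n; apply: (meval_line erefl) => k.
rewrite /complex_point /basis /xcoord /ycoord tnth_mktuple.
case: eqP => [->|_]; last by rewrite mul0r addr0.
by rewrite /= mul1r; simpc; rewrite addrC subrK.
Qed.

Lemma partial_yE w j :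
  partial_y (on_R2n f) j w = 'i%C * meval (complex_point w) (mderiv j P).
Proof.
rewrite /partial_y.
rewrite (_ : (fun t => _) = fun t =>
    (line_poly (complex_point w) (basis j 'i%C) P).[(t - ycoord w j)%:C%C]).
  by rewrite cderive1_horner coef1_basis.
apply/funext => t; rewrite /on_R2n; apply: (meval_line erefl) => k.
rewrite /complex_point /basis /xcoord /ycoord tnth_mktuple.
case: eqP => [->|_]; last by rewrite mul0r addr0.
by simpc; rewrite addrC subrK.
Qed.

(** By the Cauchy-Riemann equations the derivative along [y_j] is ['i] times
the derivative along [x_j], so that both have the same modulus. *)
Lemma gradient_normE w : gradient_norm (on_R2n f) w =
  Num.sqrt 2 * Num.sqrt (\sum_(j < n)
    cmod (meval (complex_point w) (mderiv j P)) ^+ 2).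
Proof.
have i1 : cmod 'i%C = 1 :> R by rewrite /cmod /= expr0n expr1n add0r sqrtr1.
rewrite /gradient_norm -sqrtrM//; congr Num.sqrt; rewrite mulr_sumr.
by apply: eq_bigr => j _; rewrite partial_xE partial_yE cmodM i1 mul1r mulr2n mulrDl !mul1r.
Qed.

(** The degree bound concerns a polynomial in the real coordinates. Its
restriction to the real line through [z] in the direction [v] agrees with the
restriction of [P] for real values of the parameter, hence everywhere. *)
Lemma size_line_poly_degree d (z v : 'I_n -> R[i]) :
  polynomial_degree_le d (on_R2n f) -> (size (line_poly z v P) <= d.+1)%N.
Proof.
move=> [Q [Qd fQ]].
pose pt (u : 'I_n -> R[i]) : R2n R n :=
  [tuple (complex.Re (u j), complex.Im (u j)) | j < n].
have ptK u j : complex_point (pt u) j = u j.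
  by rewrite /complex_point /xcoord /ycoord tnth_mktuple /=; case: (u j).
suff -> : line_poly z v P = line_poly (real_coords (pt z)) (real_coords (pt v)) Q.
  exact: leq_trans (size_line_poly _ _ _) Qd.
apply: poly_eq_on_nat => k; rewrite !horner_line_poly.
transitivity (f (complex_point (pt (fun j => z j + v j * k%:R)))).
  by rewrite fP; apply: meval_eq => j; rewrite ptK.
rewrite -[LHS]/(on_R2n f _) fQ; apply: meval_eq => j.
rewrite /real_coords; case: fintype.split => i.
all: rewrite /xcoord /ycoord !tnth_mktuple /=.
all: rewrite -[k%:R in LHS](rmorph_nat (real_complex R)).
all: rewrite -[k%:R in RHS](rmorph_nat (real_complex R)).
all: case: (z i) (v i) => [a b] [a' b'] /=; simpc => //=.
Qed.

End analytic_derivatives.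

(** * Measurability of complex polynomials *)

Section complex_measurable.
Context d (T : measurableType d) (R : realType).
Implicit Types f g : T -> R[i].

Definition cmeasurable f :=
  measurable_fun setT (fun x => complex.Re (f x)) /\
  measurable_fun setT (fun x => complex.Im (f x)).

Lemma cmeasurable_cst c : cmeasurable (fun=> c).
Proof. by split; exact: measurable_cst. Qed.

Lemma cmeasurableD f g : cmeasurable f -> cmeasurable g ->
  cmeasurable (fun x => f x + g x).
Proof.
move=> [f1 f2] [g1 g2]; split.
- rewrite (_ : (fun x => _) = fun x => complex.Re (f x) + complex.Re (g x)).
    exact: measurable_funD.
  by apply/funext => x; case: (f x) (g x) => [a b] [].
- rewrite (_ : (fun x => _) = fun x => complex.Im (f x) + complex.Im (g x)).
    exact: measurable_funD.
  by apply/funext => x; case: (f x) (g x) => [a b] [].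
Qed.

Lemma cmeasurableM f g : cmeasurable f -> cmeasurable g ->
  cmeasurable (fun x => f x * g x).
Proof.
move=> [f1 f2] [g1 g2]; split.
- rewrite (_ : (fun x => _) = fun x => complex.Re (f x) * complex.Re (g x) -
      complex.Im (f x) * complex.Im (g x)).
    by apply: measurable_funB; exact: measurable_funM.
  by apply/funext => x; case: (f x) (g x) => [a b] [].
- rewrite (_ : (fun x => _) = fun x => complex.Re (f x) * complex.Im (g x) +
      complex.Im (f x) * complex.Re (g x)).
    by apply: measurable_funD; exact: measurable_funM.
  by apply/funext => x; case: (f x) (g x) => [a b] [].
Qed.

Lemma cmeasurable_sum (I : Type) (r : seq I) (F : I -> T -> R[i]) :
  (forall i, cmeasurable (F i)) -> cmeasurable (fun x => \sum_(i <- r) F i x).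
Proof.
move=> mF; elim: r => [|i r ih].
  by under eq_fun do rewrite big_nil; exact: cmeasurable_cst.
by under eq_fun do rewrite big_cons; exact: cmeasurableD.
Qed.

Lemma cmeasurable_prod (I : Type) (r : seq I) (F : I -> T -> R[i]) :
  (forall i, cmeasurable (F i)) -> cmeasurable (fun x => \prod_(i <- r) F i x).
Proof.
move=> mF; elim: r => [|i r ih].
  by under eq_fun do rewrite big_nil; exact: cmeasurable_cst.
by under eq_fun do rewrite big_cons; exact: cmeasurableM.
Qed.

Lemma cmeasurableX f k : cmeasurable f -> cmeasurable (fun x => f x ^+ k).
Proof.
move=> mf; elim: k => [|k ih].
  by under eq_fun do rewrite expr0; exact: cmeasurable_cst.
by under eq_fun do rewrite exprS; exact: cmeasurableM.
Qed.

Lemma cmeasurable_meval n (P : mpoly n R[i]) (z : T -> 'I_n -> R[i]) :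
  (forall j, cmeasurable (z ^~ j)) -> cmeasurable (fun x => meval (z x) P).
Proof.
move=> mz; under eq_fun do rewrite mevalE.
apply: cmeasurable_sum => m; apply: cmeasurableM; first exact: cmeasurable_cst.
by apply: cmeasurable_prod => i; exact: cmeasurableX.
Qed.

Lemma measurable_cmod f : cmeasurable f -> measurable_fun setT (fun x => cmod (f x)).
Proof.
move=> [f1 f2].
rewrite (_ : (fun x => _) = fun x =>
  Num.sqrt (complex.Re (f x) ^+ 2 + complex.Im (f x) ^+ 2)).
  apply: (measurableT_comp (continuous_measurable_fun (@sqrt_continuous R))).
  by apply: measurable_funD; exact: measurable_funX.
by apply/funext => x; rewrite /cmod; case: (f x).
Qed.

End complex_measurable.

Lemma cmeasurable_complex_point (R : realType) n j :
  cmeasurable (fun w : R2n R n => complex_point w j).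
Proof.
split; rewrite /complex_point /= /xcoord /ycoord.
- by apply: (measurableT_comp measurable_fst); exact: measurable_tnth.
- by apply: (measurableT_comp measurable_snd); exact: measurable_tnth.
Qed.

(** * Absolute moments of a complex Gaussian variable *)

Section gaussian_moment.
Local Open Scope ereal_scope.
Variables (R : realType) (p : R).
Local Notation Rm := (measurableTypeR R).
Local Notation C2 := (Rm * Rm)%type.

Definition plane_norm (u : C2) : R := cmod (u.1 +i* u.2)%C.

Lemma measurable_plane_norm : measurable_fun setT plane_norm.
Proof. by apply: measurable_cmod; split; [exact: measurable_fst|exact: measurable_snd]. Qed.

Lemma measurable_plane_norm_powR : measurable_fun setT (fun u => (plane_norm u `^ p)%:E).
Proof.
apply/measurable_EFinP; apply: (measurableT_comp (measurable_powR p)).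
exact: measurable_plane_norm.
Qed.

Definition gaussian_moment : \bar R := \int[@cgauss R]_u (plane_norm u `^ p)%:E.

Lemma std_normal_set1 x : @std_normal R [set x] = 0.
Proof.
have /null_content_dominatesP := @normal_prob_dominates R 0 1; apply => //.
exact: lebesgue_measure_set1.
Qed.

(** Otherwise a real Gaussian variable would vanish almost surely, whereas its
law has no atom. *)
Lemma gaussian_moment_gt0 : (0 < p)%R -> 0 < gaussian_moment.
Proof.
move=> p0; rewrite lt0e; apply/andP; split; last first.
  by apply: integral_ge0 => u _; rewrite lee_fin powR_ge0.
apply/negP => /eqP k0.
have mabs : measurable_fun setT (fun x : Rm => (`|x| `^ p)%:E).
  apply/measurable_EFinP; apply: (measurableT_comp (measurable_powR p)).
  exact: (@normr_measurable R setT).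
have : \int[@std_normal R]_x (`|x| `^ p)%:E = 0.
  apply/eqP; rewrite eq_le; apply/andP; split; last first.
    by apply: integral_ge0 => u _; rewrite lee_fin powR_ge0.
  rewrite -k0 /gaussian_moment /cgauss integral_prod_measure; last 2 first.
  - exact: measurable_plane_norm_powR.
  - by move=> u; rewrite lee_fin powR_ge0.
  apply: ge0_le_integral => //.
    apply: (measurable_partial_integral _ (f := fun u => (plane_norm u `^ p)%:E)).
      exact: measurable_plane_norm_powR.
    by move=> u; rewrite lee_fin powR_ge0.
  move=> x _; rewrite -[leLHS](integral_prob_cst (@std_normal R)).
  apply: ge0_le_integral => //.
    by apply: (measurableT_comp measurable_plane_norm_powR); exact: pair1_measurable.
  move=> y _; rewrite lee_fin; apply: ge0_ler_powR => //.
  - exact: ltW.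
  - by rewrite nnegrE cmod_ge0.
  by rewrite /plane_norm /cmod /= -sqrtr_sqr ler_wsqrtr// lerDl sqr_ge0.
move=> i0; have : \int[@std_normal R]_x `|(`|x| `^ p)%:E| = 0.
  by rewrite -i0; apply: eq_integral => x _; rewrite gee0_abs// lee_fin powR_ge0.
move=> /(ae_eq_integral_abs (@std_normal R) measurableT mabs) [N [mN N0 sN]].
suff : @std_normal R setT <= 0 by rewrite probability_setT leNgt lte01.
have -> : 0 = @std_normal R N + @std_normal R [set 0%R] by rewrite N0 std_normal_set1 adde0.
apply: (@le_trans _ _ (@std_normal R (N `|` [set 0%R]))); last exact: measureU2.
apply: le_measure; rewrite ?inE//; first exact: measurableU.
move=> x _; have [->|x0] := eqVneq x 0%R; [by right|left; apply: sN => /=].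
move=> /(_ I) [] /powR_eq0_eq0 /eqP; rewrite normr_eq0; exact/negP.
Qed.

Lemma integral_tdot_powR n (c : 'I_n -> R[i]) :
  \int[gaussn R n]_w (plane_norm (tdot c w) `^ p)%:E =
  (Num.sqrt (\sum_(j < n) cmod (c j) ^+ 2) `^ p)%:E * gaussian_moment.
Proof.
rewrite (gaussn_tdot c (h := fun u => (plane_norm u `^ p)%:E)); last 2 first.
- exact: measurable_plane_norm_powR.
- by move=> u; rewrite lee_fin powR_ge0.
rewrite /gaussian_moment -ge0_integralZl//; last 2 first.
- exact: measurable_plane_norm_powR.
- by move=> u _; rewrite lee_fin powR_ge0.
apply: eq_integral => u _; rewrite -EFinM -powRM ?sqrtr_ge0 ?cmod_ge0//.
congr (_ `^ _)%:E; set r := Num.sqrt _.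
rewrite -[r in RHS]cmod_real ?sqrtr_ge0// -cmodM; congr cmod.
by apply/eqP; rewrite eq_complex /=; apply/andP; split; apply/eqP => /=; ring.
Qed.

End gaussian_moment.

(** * The gradient inequality *)

Section bernstein.
Local Open Scope ereal_scope.
Variable R : realType.
Local Notation Rm := (measurableTypeR R).
Local Notation C2 := (Rm * Rm)%type.

Lemma complex_point_tscale n a (w : R2n R n) j :
  complex_point (tscale a w) j = (a * complex_point w j)%R.
Proof.
rewrite /complex_point /xcoord /ycoord tnth_mktuple /plane_mul /affine2 /=.
by case: a => b c; apply/eqP; rewrite eq_complex /=; apply/andP; split; apply/eqP => /=; ring.
Qed.

Lemma complex_point_tadd n (z w : R2n R n) j :
  complex_point (tadd z w) j = (complex_point z j + complex_point w j)%R.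
Proof. by rewrite /complex_point /xcoord /ycoord tnth_mktuple. Qed.

Lemma plane_norm_tdot n (c : 'I_n -> R[i]) (w : R2n R n) :
  plane_norm (tdot c w) = cmod (\sum_(j < n) c j * complex_point w j)%R.
Proof.
rewrite /plane_norm; congr cmod; apply/eqP; rewrite eq_complex /=; apply/andP.
rewrite !raddf_sum /=; split; apply/eqP; apply: eq_bigr => j _;
  rewrite /plane_mul /affine2 /complex_point /xcoord /ycoord /=;
  by case: (c j) => a b /=; ring.
Qed.

Lemma integral_rotation_average d (T : measurableType d)
    (m : {measure set T -> \bar R}) (r : rotation_average R)
    (G : 'I_(avg_size r) -> T -> \bar R) (A : \bar R) :
  (forall k, measurable_fun setT (G k)) -> (forall k x, 0 <= G k x) ->
  (forall k, \int[m]_x G k x = A) ->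
  \int[m]_x (\sum_(k < avg_size r) (avg_weight k)%:E * G k x) = A.
Proof.
move=> mG G0 GA; rewrite ge0_integral_sum//; last 2 first.
- by move=> k; exact: measurable_funeM.
- by move=> k x _; rewrite mule_ge0// lee_fin avg_weight_ge0.
transitivity (\sum_(k < avg_size r) (avg_weight k)%:E * A).
  by apply: eq_bigr => k _; rewrite ge0_integralZl ?GA// lee_fin avg_weight_ge0.
rewrite -ge0_sume_distrl => [|k _]; last by rewrite lee_fin avg_weight_ge0.
by rewrite sumEFin avg_weight_sum mul1e.
Qed.

Variables (p : R) (n d : nat).
Hypothesis p1 : (1 < p)%R.
Variables (P : mpoly n R[i]) (f : ('I_n -> R[i]) -> R[i]).
Hypothesis fP : forall z, f z = meval z P.
Hypothesis fd : polynomial_degree_le d (on_R2n f).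

Let F (w : n.-tuple C2) : \bar R := (cmod (on_R2n f w) `^ p)%:E.

Let F0 w : 0 <= F w. Proof. by rewrite lee_fin powR_ge0. Qed.

Lemma measurable_cmod_meval (Q : mpoly n R[i]) :
  measurable_fun setT (fun w : R2n R n => cmod (meval (complex_point w) Q)).
Proof.
apply: measurable_cmod; apply: cmeasurable_meval => j.
exact: cmeasurable_complex_point.
Qed.

Let mF : measurable_fun setT F.
Proof.
apply/measurable_EFinP; apply: (measurableT_comp (measurable_powR p)).
rewrite /on_R2n; under eq_fun do rewrite fP.
exact: measurable_cmod_meval.
Qed.

(** The pointwise bound [horner_dilation] on the line through [w], integrated:
every rotation in the average preserves the Gaussian measure. *)
Lemma integral_dilation_le (s : R) : (1 <= s)%R ->
  \int[gaussn R n]_w F (tscale s%:C%C w) <=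
  ((s ^+ d) `^ p)%:E * \int[gaussn R n]_w F w.
Proof.
move=> s1; have [r hr] := horner_dilation d p1 s1.
pose z0 : 'I_n -> R[i] := fun=> 0%R.
have fE t w : on_R2n f (tscale t w) = (line_poly z0 (complex_point w) P).[t]%R.
  rewrite /on_R2n; apply: (meval_line fP erefl) => j.
  by rewrite complex_point_tscale add0r mulrC.
have mFs t : measurable_fun setT (fun w => F (tscale t w)).
  by apply: (measurableT_comp mF); apply: measurable_tscale; exact: measurable_id.
have avgE : \int[gaussn R n]_w (\sum_(k < avg_size r)
    (avg_weight k)%:E * F (tscale (avg_angle k) w)) = \int[gaussn R n]_w F w.
  apply: (integral_rotation_average (G := fun k w => F (tscale (avg_angle k) w))) => k.
  - exact: mFs.
  - by move=> w; exact: F0.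
  by apply: gaussn_phase => //; exact: avg_angle_unit.
rewrite -avgE.
have msum : measurable_fun setT (fun w => \sum_(k < avg_size r)
    (avg_weight k)%:E * F (tscale (avg_angle k) w)).
  by apply: emeasurable_sum => k; exact: measurable_funeM.
have sum0 w : 0 <= \sum_(k < avg_size r) (avg_weight k)%:E * F (tscale (avg_angle k) w).
  by apply: sume_ge0 => k _; rewrite mule_ge0// lee_fin avg_weight_ge0.
rewrite -ge0_integralZl//; last by rewrite lee_fin powR_ge0.
apply: ge0_le_integral => //.
  exact: measurable_funeM.
move=> w _; rewrite /F; under eq_bigr do rewrite -EFinM fE.
rewrite sumEFin -EFinM lee_fin fE; apply: hr.
exact: (size_line_poly_degree fP).
Qed.

Let S (w : R2n R n) : R :=
  Num.sqrt (\sum_(j < n) cmod (meval (complex_point w) (mderiv j P)) ^+ 2).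

Lemma measurable_S : measurable_fun setT S.
Proof.
apply: (measurableT_comp (continuous_measurable_fun (@sqrt_continuous R))).
by apply: measurable_sum => j; apply: measurable_funX; exact: measurable_cmod_meval.
Qed.

(** The left-hand side is the integral over [w] and [v] of the [p]-th power of
the modulus of [r * sum_j D_j(w) v_j], to which [coef1_circle] applies for
every [w] and [v]; the values [f (w + u r v)] on the right have the law of a
dilated Gaussian vector. *)
Lemma integral_derivative_le (r : R) : (0 < d)%N -> (0 < r)%R ->
  gaussian_moment p * \int[gaussn R n]_w ((r * S w) `^ p)%:E <=
  \int[gaussn R n]_w F (tscale (Num.sqrt (1 + r ^+ 2))%:C%C w).
Proof.
move=> d0 r0; have [rt hr] := coef1_circle p1 d0.
have k0 : 0 <= gaussian_moment p.
  by apply: integral_ge0 => u _; rewrite lee_fin powR_ge0.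
have mS : measurable_fun setT (fun w => ((r * S w) `^ p)%:E).
  apply/measurable_EFinP; apply: (measurableT_comp (measurable_powR p)).
  by apply: measurable_funM => //; exact: measurable_S.
rewrite -ge0_integralZl//; last by move=> w _; rewrite lee_fin powR_ge0.
(* The factor [1] gives the argument the form required by [gaussn_comb]. *)
pose G (k : 'I_(avg_size rt)) (w v : n.-tuple C2) :=
  F (tadd (tscale 1%R w) (tscale (r%:C%C * avg_angle k)%R v)).
have mG (k : 'I_(avg_size rt)) : measurable_fun setT (fun x : n.-tuple C2 * n.-tuple C2 =>
    G k x.1 x.2).
  by apply: (measurableT_comp mF); apply: measurable_tadd; apply: measurable_tscale.
have mGw k w : measurable_fun setT (fun v => G k w v).
  apply: (measurableT_comp mF); apply: measurable_tadd; apply: measurable_tscale.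
  - exact: measurable_cst.
  - exact: measurable_id.
have mI k : measurable_fun setT (fun w => \int[gaussn R n]_v G k w v).
  apply: (measurable_partial_integral _ (f := fun x => G k x.1 x.2)) => [|x].
    exact: mG.
  exact: F0.
have avgE : \int[gaussn R n]_w (\sum_(k < avg_size rt)
    (avg_weight k)%:E * \int[gaussn R n]_v G k w v) =
    \int[gaussn R n]_w F (tscale (Num.sqrt (1 + r ^+ 2))%:C%C w).
  apply: (integral_rotation_average
    (G := fun k w => \int[gaussn R n]_v G k w v)) => k.
  - exact: mI.
  - by move=> w; apply: integral_ge0 => v _; exact: F0.
  transitivity (\int[gaussn R n]_w F (tscale (Num.sqrt
      (cmod 1 ^+ 2 + cmod (r%:C%C * avg_angle k) ^+ 2)%R)%:C%C w)).
    exact: gaussn_comb.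
  apply: eq_integral => w _; congr (F (tscale (Num.sqrt _)%:C%C w)).
  rewrite cmodM avg_angle_unit mulr1 cmod_real ?ltW//.
  by rewrite -(rmorph1 (real_complex R)) cmod_real ?ler01// expr1n.
rewrite -avgE.
apply: ge0_le_integral => //.
- by move=> w _; rewrite mule_ge0// lee_fin powR_ge0.
- exact: measurable_funeM.
- by apply: emeasurable_sum => k; exact: measurable_funeM.
move=> w _.
pose c j := (r%:C%C * meval (complex_point w) (mderiv j P))%R.
have -> : gaussian_moment p * ((r * S w) `^ p)%:E =
    \int[gaussn R n]_v (plane_norm (tdot c v) `^ p)%:E.
  rewrite integral_tdot_powR muleC; congr (_ * _)%E; congr (_ `^ _)%:E.
  rewrite /S -{1}(ger0_norm (ltW r0)) -sqrtr_sqr -sqrtrM ?sqr_ge0// mulr_sumr.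
  by congr Num.sqrt; apply: eq_bigr => j _; rewrite cmodM cmod_real ?ltW// exprMn.
have -> : \sum_(k < avg_size rt) (avg_weight k)%:E * \int[gaussn R n]_v G k w v =
    \int[gaussn R n]_v \sum_(k < avg_size rt) (avg_weight k)%:E * G k w v.
  rewrite ge0_integral_sum//; last 2 first.
  - by move=> k; exact: measurable_funeM.
  - move=> k v _; apply: mule_ge0; last exact: F0.
    by rewrite lee_fin avg_weight_ge0.
  apply: eq_bigr => k _; apply/esym; apply: ge0_integralZl => [//||v _|].
  - exact: mGw.
  - exact: F0.
  - by rewrite lee_fin avg_weight_ge0.
apply: ge0_le_integral => //.
- by move=> v _; rewrite lee_fin powR_ge0.
- by apply: (measurableT_comp (measurable_plane_norm_powR p)); exact: measurable_tdot.
- by apply: emeasurable_sum => k; exact: measurable_funeM.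
move=> v _.
pose q := line_poly (complex_point w) (fun j => r%:C%C * complex_point v j)%R P.
have -> : plane_norm (tdot c v) = cmod q`_1%R.
  rewrite plane_norm_tdot line_poly_coef1; congr cmod; apply: eq_bigr => j _.
  by rewrite /c mulrAC.
rewrite /G /F; under eq_bigr do rewrite -EFinM.
rewrite sumEFin lee_fin.
rewrite (eq_bigr (fun k => avg_weight k * cmod q.[avg_angle k] `^ p)%R).
  by apply: hr; exact: (size_line_poly_degree fP).
move=> k _; congr (_ * cmod _ `^ _)%R.
rewrite /on_R2n; apply: (meval_line fP erefl) => j.
by rewrite complex_point_tadd !complex_point_tscale mul1r; congr (_ + _)%R; ring.
Qed.

End bernstein.

Section gradient_estimate.
Local Open Scope ereal_scope.
Variable R : realType.
Local Notation Rm := (measurableTypeR R).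
Local Notation C2 := (Rm * Rm)%type.

Lemma Lpnorm_gaussianE (p : R) n (g : R2n R n -> R) :
  measurable_fun setT g -> (forall w, (0 <= g w)%R) ->
  Lpnorm_gaussian p g = (\int[gaussn R n]_w (g w `^ p)%:E) `^ p^-1.
Proof.
move=> mg g0; rewrite /Lpnorm_gaussian unlock; congr (_ `^ _).
transitivity (\int[@gaussian_measure R n]_w (g w `^ p)%:E).
  by apply: eq_integral => w _; rewrite /= ger0_norm.
apply: integral_gaussian_measure => [|w]; last by rewrite lee_fin powR_ge0.
by apply/measurable_EFinP; exact: (measurableT_comp (measurable_powR p)).
Qed.

(** The left-hand side is [(1 + 1/d)^(d/2)], and [1 + x <= exp x]. *)
Lemma dilation_pow_le (d : nat) : (0 < d)%N ->
  (Num.sqrt (1 + (Num.sqrt d%:R)^-1 ^+ 2) ^+ d <= expR 1 :> R)%R.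
Proof.
move=> d0; set s := Num.sqrt _.
have d1 : (0 < d%:R :> R)%R by rewrite ltr0n.
have s2 : (s ^+ 2 = 1 + d%:R^-1)%R.
  by rewrite sqr_sqrtr ?addr_ge0 ?sqr_ge0// exprVn sqr_sqrtr// ltW.
have s1 : (1 <= s)%R.
  by rewrite -[1%R in leLHS]sqrtr1 ler_wsqrtr// lerDl sqr_ge0.
apply: (@le_trans _ _ ((s ^+ d) ^+ 2)%R).
  by rewrite expr2 ler_peMr ?exprn_ege1// exprn_ge0// (le_trans ler01).
rewrite exprAC s2 -[leRHS](_ : expR (d%:R^-1) ^+ d = _)%R; last first.
  by rewrite -expRM_natl mulfV// gt_eqF.
by rewrite lerXn2r ?nnegrE ?expR_ge0 ?expR_ge1Dx.
Qed.

(** Combine the two previous estimates for [r = d^(-1/2)]. The moment is an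
extended real number; [k0] is a real number below it. *)
Lemma integral_gradient_le (p : R) (k0 : R) n d (P : mpoly n R[i])
    (f : ('I_n -> R[i]) -> R[i]) : (1 < p)%R ->
  (0 < k0)%R -> k0%:E <= @gaussian_moment R p ->
  (forall z, f z = meval z P) -> polynomial_degree_le d (on_R2n f) -> (0 < d)%N ->
  \int[gaussn R n]_w (gradient_norm (on_R2n f) w `^ p)%:E <=
  (((Num.sqrt 2 * expR 1 * k0^-1 `^ p^-1) * Num.sqrt d%:R) `^ p)%:E *
  \int[gaussn R n]_w (cmod (on_R2n f w) `^ p)%:E.
Proof.
move=> p1 k00 k0k fP fd d0; have p0 : (0 < p)%R := lt_trans ltr01 p1.
set A := \int[_]_w (cmod _ `^ _)%:E.
have A0 : 0 <= A by apply: integral_ge0 => w _; rewrite lee_fin powR_ge0.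
have sd0 : (0 < Num.sqrt d%:R :> R)%R by rewrite sqrtr_gt0 ltr0n.
set r : R := (Num.sqrt d%:R)^-1%R.
have r0 : (0 < r)%R by rewrite invr_gt0.
set s := Num.sqrt (1 + r ^+ 2).
have s1 : (1 <= s)%R.
  by rewrite -[1%R in leLHS]sqrtr1 ler_wsqrtr// lerDl sqr_ge0.
pose S (w : R2n R n) : R :=
  Num.sqrt (\sum_(j < n) cmod (meval (complex_point w) (mderiv j P)) ^+ 2).
have mS : measurable_fun setT S := measurable_S P.
have mrS : measurable_fun setT (fun w => ((r * S w) `^ p)%:E).
  apply/measurable_EFinP; apply: (measurableT_comp (measurable_powR p)).
  exact: measurable_funM.
set B := \int[gaussn R n]_w ((r * S w) `^ p)%:E.
have B0 : 0 <= B by apply: integral_ge0 => w _; rewrite lee_fin powR_ge0.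
have k0B : k0%:E * B <= (expR 1 `^ p)%:E * A.
  apply: (@le_trans _ _ (gaussian_moment p * B)); first exact: lee_wpmul2r.
  apply: (le_trans (integral_derivative_le p1 fP fd d0 r0)).
  apply: (le_trans (integral_dilation_le p1 fP fd s1)).
  apply: lee_wpmul2r => //; rewrite lee_fin; apply: ge0_ler_powR.
  - exact: ltW.
  - by rewrite nnegrE exprn_ge0// (le_trans ler01).
  - by rewrite nnegrE expR_ge0.
  - exact: dilation_pow_le.
have BA : B <= (k0^-1 * expR 1 `^ p)%:E * A.
  have -> : B = k0^-1%:E * (k0%:E * B).
    by rewrite muleA -EFinM mulVf ?gt_eqF// mul1e.
  rewrite EFinM -muleA; apply: lee_wpmul2l; last exact: k0B.
  by rewrite lee_fin invr_ge0 ltW.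
have -> : \int[gaussn R n]_w (gradient_norm (on_R2n f) w `^ p)%:E =
    ((Num.sqrt 2 * Num.sqrt d%:R) `^ p)%:E * B.
  rewrite -ge0_integralZl//; last by move=> w _; rewrite lee_fin powR_ge0.
  apply: eq_integral => w _; rewrite -EFinM -powRM ?mulr_ge0 ?sqrtr_ge0 ?ltW//.
  congr (_ `^ _)%:E; rewrite (gradient_normE fP) -/(S w) /r.
  by field; rewrite gt_eqF.
have -> : ((Num.sqrt 2 * expR 1 * k0^-1 `^ p^-1 * Num.sqrt d%:R) `^ p =
    (Num.sqrt 2 * Num.sqrt d%:R) `^ p * (k0^-1 * expR 1 `^ p) :> R)%R.
  rewrite -[X in (_ * (X * _))%R](_ : (k0^-1 `^ p^-1) `^ p = _)%R; last first.
    by rewrite -powRrM mulVf ?gt_eqF// powRr1// invr_ge0 ltW.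
  rewrite -!powRM ?mulr_ge0 ?sqrtr_ge0 ?expR_ge0 ?powR_ge0//.
  by congr (_ `^ _)%R; ring.
by rewrite EFinM -muleA; apply: lee_wpmul2l => //; rewrite lee_fin powR_ge0.
Qed.

End gradient_estimate.

Theorem theorem4 (R : realType) (p : R) (hp : 1 < p) :
  exists C : R,
    forall (n d : nat) (f : ('I_n -> R[i]) -> R[i]),
      (1 <= n)%N ->
      analytic_polynomial f ->
      polynomial_degree_le d (on_R2n f) ->
      (Lpnorm_gaussian p (gradient_norm (on_R2n f)) <=
       (C * Num.sqrt d%:R)%:E *
       Lpnorm_gaussian p (fun w => cmod (on_R2n f w)))%E.
Proof.
have p0 : 0 < p := lt_trans ltr01 hp.
have [k0 k00 k0k] : exists2 k0 : R, 0 < k0 & (k0%:E <= @gaussian_moment R p)%E.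
  have := gaussian_moment_gt0 p0; case: (gaussian_moment p) => [k k0||//].
    by exists k.
  by exists 1 => //; exact: leey.
exists (Num.sqrt 2 * expR 1 * k0^-1 `^ p^-1) => n d f _ [P fP] fd.
have mf : measurable_fun setT (fun w => cmod (on_R2n f w)).
  by rewrite /on_R2n; under eq_fun do rewrite fP; exact: measurable_cmod_meval.
have gE : gradient_norm (on_R2n f) = fun w => Num.sqrt 2 * Num.sqrt (\sum_(j < n)
    cmod (meval (complex_point w) (mderiv j P)) ^+ 2).
  by apply/funext => w; exact: gradient_normE.
have mg : measurable_fun setT (gradient_norm (on_R2n f)).
  by rewrite gE; apply: measurable_funM => //; exact: measurable_S.
rewrite !Lpnorm_gaussianE//; last 2 first.
- by move=> w; exact: cmod_ge0.
- by move=> w; exact: sqrtr_ge0.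
set A := (\int[_]_w (cmod _ `^ _)%:E)%E.
have A0 : (0 <= A)%E by apply: integral_ge0 => w _; rewrite lee_fin powR_ge0.
have c0 : 0 <= Num.sqrt 2 * expR 1 * k0^-1 `^ p^-1 * Num.sqrt d%:R.
  by rewrite !mulr_ge0 ?sqrtr_ge0 ?expR_ge0 ?powR_ge0.
have [d0|d0] := posnP d.
  (* Here [d^(-1/2)] makes no sense, but [f] is constant. *)
  rewrite [X in (X `^ _ <= _)%E](_ : _ = 0%E).
    rewrite poweR0r ?invr_eq0 ?gt_eqF//.
    by rewrite mule_ge0 ?poweR_ge0// lee_fin.
  apply: integral0_eq => w _; rewrite gE big1 ?sqrtr0 ?mulr0 ?powR0 ?gt_eqF// => j _.
  suff -> : meval (complex_point w) (mderiv j P) = 0.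
    by rewrite /cmod ComplexField.Normc.normc0 expr0n.
  have := line_poly_coef1 (complex_point w) (fun k => (k == j)%:R) P.
  rewrite nth_default => [|]; last first.
    have := size_line_poly_degree fP (complex_point w)
      (fun k => (k == j)%:R) fd.
    by rewrite d0.
  rewrite (bigD1 j)//= eqxx mul1r big1 ?addr0 => [<-//|k /negbTE ->].
  by rewrite mul0r.
apply: (@le_trans _ _ (((((Num.sqrt 2 * expR 1 * k0^-1 `^ p^-1) *
    Num.sqrt d%:R) `^ p)%:E * A) `^ p^-1)%E).
  apply: gt0_ler_poweR; rewrite ?in_itv/= ?invr_ge0 ?(ltW p0)//.
  - rewrite leey andbT; apply: integral_ge0 => w _; rewrite lee_fin powR_ge0//.
  - by rewrite leey andbT mule_ge0// lee_fin powR_ge0.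
  exact: integral_gradient_le.
rewrite poweRM ?lee_fin ?powR_ge0// poweR_EFin -powRrM mulfV ?gt_eqF// powRr1//.
Qed.
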